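(* Let $(R,\Lambda)$ be a Noetherian algebra, and let $\Phi_{\rm t}:\mathsf{tors}\,\Lambda\to\mathbb T_R(\Lambda)$ be the map $\mathcal T\mapsto(\mathcal T_{\mathfrak p}\cap\mathsf{fl}\,\Lambda_{\mathfrak p})_{\mathfrak p\in\operatorname{Spec}R}$. Then $\operatorname{Im}\Phi_{\rm t}\subseteq\mathbb T_R^{\rm c}(\Lambda)$. Thus there is an embedding of posets $$\Phi_{\rm t}:\mathsf{tors}\,\Lambda\hookrightarrow\mathbb T_R^{\rm c}(\Lambda).$$
   Context: A Noetherian algebra $(R,\Lambda)$ is a commutative Noetherian ring $R$ with a (not necessarily commutative) $R$-algebra $\Lambda$ that is finitely generated as an $R$-module. $\Lambda_{\mathfrak p}:=R_{\mathfrak p}\otimes_R\Lambda$. $\mathsf{mod}$ and $\mathsf{fl}$ denote finitely generated, respectively finite length, left modules. A torsion class of an abelian category is a full subcategory (containing $0$, closed under isomorphisms) closed under extensions and factor objects; $\mathsf{tors}\,\mathcal A$ is the set of torsion classes of $\mathcal A$ ordered by inclusion, $\mathsf{tors}\,\Lambda:=\mathsf{tors}(\mathsf{mod}\,\Lambda)$. For a subcategory $\mathcal C$ of modules, $\mathcal C_{\mathfrak p}:=\{X_{\mathfrak p}\mid X\in\mathcal C\}$. Put $\mathbb T_R(\Lambda):=\prod_{\mathfrak p\in\operatorname{Spec}R}\mathsf{tors}(\mathsf{fl}\,\Lambda_{\mathfrak p})$ with componentwise order. For $\mathcal X\in\mathsf{tors}(\mathsf{fl}\,\Lambda_{\mathfrak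 p})$ let $\psi_{\mathfrak p}(\mathcal X):=\{X\in\mathsf{mod}\,\Lambda_{\mathfrak p}\mid X/\mathfrak pX\in\mathcal X\}\in\mathsf{tors}\,\Lambda_{\mathfrak p}$, and for primes $\mathfrak p\supseteq\mathfrak q$ define ${\rm r}_{\mathfrak p,\mathfrak q}:\mathsf{tors}(\mathsf{fl}\,\Lambda_{\mathfrak p})\to\mathsf{tors}(\mathsf{fl}\,\Lambda_{\mathfrak q})$ by ${\rm r}_{\mathfrak p,\mathfrak q}(\mathcal X):=\psi_{\mathfrak p}(\mathcal X)_{\mathfrak q}\cap\mathsf{fl}\,\Lambda_{\mathfrak q}$. An element $(\mathcal X^{\mathfrak p})_{\mathfrak p}\in\mathbb T_R(\Lambda)$ is compatible if ${\rm r}_{\mathfrak p,\mathfrak q}(\mathcal X^{\mathfrak p})\supseteq\mathcal X^{\mathfrak q}$ for all pairs of primes $\mathfrak p\supseteq\mathfrak q$; $\mathbb T^{\rm c}_R(\Lambda)$ is the subposet of compatible elements. An embedding of posets is an order-preserving map $f$ such that $f(a)\le f(b)$ implies $a\le b$. *)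

(* Defs.v *)
From HB Require Import structures.
From mathcomp Require Import all_boot all_order all_algebra.
From mathcomp Require Import ring boolp classical_sets.

Set Implicit Arguments.
Unset Strict Implicit.
Unset Printing Implicit Defensive.

Import GRing.Theory.
Local Open Scope ring_scope.
Local Open Scope quotient_scope.
Local Open Scope classical_set_scope.

(* Rings and modules are taken in MathComp's "possibly zero" hierarchy (pz):
   the zero ring must be allowed, since the localization of an algebra at a
   prime outside its support vanishes.  For the same reason algType, which
   excludes the zero algebra, is replaced by an explicit central map. *)

Record pzAlg (R : comPzRingType) := PzAlg {
  alg_ring :> pzRingType;
  alg_map : {rmorphism R -> alg_ring};
  alg_central : forall r a, alg_map r * a = a * alg_map r }.

Definition ideal (R : comPzRingType) (I : set R) : Prop :=
  [/\ I 0, forall x y, I x -> I y -> I (x + y) & forall a x, I x -> I (a * x)].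

Definition noetherian (R : comPzRingType) : Prop :=
  forall I : set R, ideal I ->
    exists (n : nat) (g : 'I_n -> R), (forall i, I (g i)) /\
      forall x, I x -> exists c : 'I_n -> R, x = \sum_i c i * g i.

Definition prime_ideal (R : comPzRingType) (p : set R) : Prop :=
  [/\ ideal p, ~ p 1 & forall a b, p (a * b) -> p a \/ p b].

Record spec (R : comPzRingType) := Spec {
  spec_set :> set R;
  spec_prime : prime_ideal spec_set }.

Definition isom (A : pzRingType) (M N : lmodType A) : Prop :=
  exists f : {linear M -> N}, bijective f.

Definition short_exact (A : pzRingType) (M N P : lmodType A)
    (f : {linear M -> N}) (g : {linear N -> P}) : Prop :=
  [/\ injective f, forall y, g y = 0 <-> exists x, f x = y
    & forall z, exists y, g y = z].

Definition fingen (A : pzRingType) (M : lmodType A) : Prop :=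
  exists (n : nat) (g : 'I_n -> M),
    forall x, exists c : 'I_n -> A, x = \sum_i c i *: g i.

Record submod (A : pzRingType) (M : lmodType A) := Submod {
  submod_set :> set M;
  submod0 : submod_set 0;
  submodD : forall x y, submod_set x -> submod_set y -> submod_set (x + y);
  submodZ : forall a x, submod_set x -> submod_set (a *: x) }.

Definition finlen (A : pzRingType) (M : lmodType A) : Prop :=
  exists (n : nat) (F : nat -> submod M),
    [/\ (F 0%N : set M) = [set 0], (F n : set M) = setT &
        forall i, (i < n)%N -> (F i : set M) `<` F i.+1 /\
          forall N : submod M, F i `<=` N -> N `<=` F i.+1 ->
            (N : set M) = F i \/ (N : set M) = F i.+1].

Definition restr (A B : pzRingType) (f : {rmorphism A -> B})
  (M : lmodType B) : Type := M.

Section Restriction.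
Variables (A B : pzRingType) (f : {rmorphism A -> B}) (M : lmodType B).

HB.instance Definition _ := GRing.Zmodule.copy (restr f M) M.

Let rscale (a : A) (x : restr f M) : restr f M := f a *: (x : M).

Fact rscaleA a b x : rscale a (rscale b x) = rscale (a * b) x.
Proof. by rewrite /rscale scalerA rmorphM. Qed.
Fact rscale1 : left_id 1 rscale.
Proof. by move=> x; rewrite /rscale rmorph1 scale1r. Qed.
Fact rscaleDr : right_distributive rscale +%R.
Proof. by move=> a x y; rewrite /rscale scalerDr. Qed.
Fact rscaleDl x : {morph rscale^~ x : a b / a + b}.
Proof. by move=> a b; rewrite /rscale rmorphD scalerDl. Qed.

HB.instance Definition _ := GRing.Zmodule_isLmodule.Build A (restr f M)
  rscaleA rscale1 rscaleDr rscaleDl.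
End Restriction.

Section Quotient.
Variables (A : pzRingType) (M : lmodType A) (N : submod M).

Let inN : set M := N.

Definition qmod_rel (x y : M) : bool := `[< inN (x - y) >].

Let inNN x : inN x -> inN (- x).
Proof. by rewrite -scaleN1r; apply: submodZ. Qed.

Fact qmod_relP : equiv_class_of qmod_rel.
Proof.
have sym x y : qmod_rel x y -> qmod_rel y x.
  by move=> /asboolP/inNN; rewrite opprB => ?; apply/asboolP.
split=> [x|x y|y x z].
- by apply/asboolP; rewrite /inN subrr; apply: submod0.
- by apply/idP/idP; apply: sym.
- move=> /asboolP Nxy /asboolP Nyz; apply/asboolP.
  by rewrite -(subrK y x) -addrA; apply: submodD.
Qed.

Canonical qmod_equiv := EquivRelPack qmod_relP.

Definition qmod : Type := {eq_quot qmod_equiv}.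

HB.instance Definition _ := Choice.on qmod.

Definition qproj (x : M) : qmod := \pi_({eq_quot qmod_equiv}) x.

Fact qprojP x y : qproj x = qproj y <-> inN (x - y).
Proof.
split=> [/eqP|Nxy]; first by rewrite eqmodE => /asboolP.
by apply/eqP; rewrite eqmodE; apply/asboolP.
Qed.

Fact qproj_surj (m : qmod) : exists x, m = qproj x.
Proof. by exists (repr m); rewrite /qproj reprK. Qed.

Let lift (m : qmod) : M := repr m.

Fact qliftK m : qproj (lift m) = m. Proof. exact: reprK. Qed.

Let qadd m n := qproj (lift m + lift n).
Let qopp m := qproj (- lift m).
Let qscale a m := qproj (a *: lift m).

Let liftP x : inN (lift (qproj x) - x).
Proof. by apply/qprojP; rewrite qliftK. Qed.

Let qaddE x y : qadd (qproj x) (qproj y) = qproj (x + y).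
Proof.
by apply/qprojP; rewrite opprD addrACA; apply: submodD; apply: liftP.
Qed.
Let qoppE x : qopp (qproj x) = qproj (- x).
Proof. by apply/qprojP; rewrite -opprD; apply: inNN; apply: liftP. Qed.
Let qscaleE a x : qscale a (qproj x) = qproj (a *: x).
Proof. by apply/qprojP; rewrite -scalerBr; apply: submodZ; apply: liftP. Qed.

Fact qaddA : associative qadd.
Proof.
move=> m n o; have [x ->] := qproj_surj m; have [y ->] := qproj_surj n.
have [z ->] := qproj_surj o.
by rewrite !qaddE addrA.
Qed.
Fact qaddC : commutative qadd.
Proof. by move=> m n; rewrite /qadd addrC. Qed.
Fact qadd0 : left_id (qproj 0) qadd.
Proof. by move=> m; have [x ->] := qproj_surj m; rewrite qaddE add0r. Qed.
Fact qaddN : left_inverse (qproj 0) qopp qadd.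
Proof. by move=> m; have [x ->] := qproj_surj m; rewrite qoppE qaddE addNr. Qed.

HB.instance Definition _ := GRing.isZmodule.Build qmod qaddA qaddC qadd0 qaddN.

Fact qscaleA a b m : qscale a (qscale b m) = qscale (a * b) m.
Proof. by have [x ->] := qproj_surj m; rewrite !qscaleE scalerA. Qed.
Fact qscale1 : left_id 1 qscale.
Proof. by move=> m; have [x ->] := qproj_surj m; rewrite qscaleE scale1r. Qed.
Fact qscaleDr : right_distributive qscale +%R.
Proof.
move=> a m n; have [x ->] := qproj_surj m; have [y ->] := qproj_surj n.
by rewrite /+%R /= qaddE !qscaleE qaddE scalerDr.
Qed.
Fact qscaleDl m : {morph qscale^~ m : a b / a + b}.
Proof.
move=> a b; have [x ->] := qproj_surj m.
by rewrite !qscaleE [RHS]qaddE scalerDl.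
Qed.

HB.instance Definition _ := GRing.Zmodule_isLmodule.Build A qmod
  qscaleA qscale1 qscaleDr qscaleDl.

Fact qproj_is_linear : linear qproj.
Proof.
move=> a x y; have -> : a *: qproj x = qproj (a *: x) by exact: qscaleE.
exact/esym/qaddE.
Qed.

HB.instance Definition _ := GRing.isLinear.Build A M qmod *:%R qproj
  qproj_is_linear.

End Quotient.

Section Localization.
Variables (R : comPzRingType) (p : spec R).

Record den : Type := Den { den_val : R; den_valP : den_val \notin (p : set R) }.

HB.instance Definition _ := [isSub for den_val].
HB.instance Definition _ := [Choice of den by <:].

Fact den_one_subproof : 1 \notin (p : set R).
Proof. by rewrite notin_setE; case: (spec_prime p). Qed.
Fact den_mul_subproof (s t : den) : den_val s * den_val t \notin (p : set R).
Proof.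
move: (den_valP s) (den_valP t); rewrite !notin_setE => sp tp.
by case: (spec_prime p) => _ _ /[apply] -[].
Qed.

Definition den_one : den := Den den_one_subproof.
Definition den_mul (s t : den) : den := Den (den_mul_subproof s t).

Fact den_mulC : commutative den_mul.
Proof. by move=> s t; apply: val_inj; rewrite /= mulrC. Qed.
Fact den_mulA : associative den_mul.
Proof. by move=> s t u; apply: val_inj; rewrite /= mulrA. Qed.
Fact den_mul1 : left_id den_one den_mul.
Proof. by move=> s; apply: val_inj; rewrite /= mul1r. Qed.

Variable (A : pzAlg R).

(* M_p is built from fractions x / s; tens_universal below identifies it with
   R_p (x)_R M. *)
Section Module.
Variable M : lmodType A.

Local Notation "r .* x" := (alg_map A r *: x)
  (at level 40, left associativity).

Fact rmulA r s (x : M) : r .* (s .* x) = (r * s) .* x.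
Proof. by rewrite scalerA rmorphM. Qed.

Let rmul_subst k a b r r' (x y : M) :
  a .* x = b .* y -> r = k * a -> r' = k * b -> r .* x = r' .* y.
Proof. by move=> e -> ->; rewrite -!rmulA e. Qed.

Definition loc_rel (a b : M * den) : bool :=
  `[< exists u : den, (den_val u * den_val b.2) .* a.1 =
                      (den_val u * den_val a.2) .* b.1 >].

Fact loc_relP : equiv_class_of loc_rel.
Proof.
have sym a b : loc_rel a b -> loc_rel b a.
  by move=> /asboolP[u e]; apply/asboolP; exists u.
split=> [a|a b|b a c]; first by apply/asboolP; exists den_one.
  by apply/idP/idP; apply: sym.
case: a b c => [x s] [y t] [z v] /asboolP[/= u1 e1] /asboolP[/= u2 e2].
apply/asboolP; exists (den_mul (den_mul u1 u2) t) => /=.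
apply: etrans (_ : (den_val u1 * den_val u2 * den_val s * den_val v) .* y = _).
  by apply: (rmul_subst (k := den_val u2 * den_val v) e1); ring.
by apply: (rmul_subst (k := den_val u1 * den_val s) e2); ring.
Qed.

Canonical loc_equiv := EquivRelPack loc_relP.

Definition loc : Type := {eq_quot loc_equiv}.

HB.instance Definition _ := Choice.on loc.

Definition frac (x : M) (s : den) : loc := \pi_({eq_quot loc_equiv}) (x, s).

Fact fracP x y s t : frac x s = frac y t <->
  exists u : den, (den_val u * den_val t) .* x = (den_val u * den_val s) .* y.
Proof.
split=> [/eqP|e]; first by rewrite eqmodE => /asboolP.
by apply/eqP; rewrite eqmodE; apply/asboolP.
Qed.

Definition numer (m : loc) : M := (repr m).1.
Definition denom (m : loc) : den := (repr m).2.

Fact fracK m : frac (numer m) (denom m) = m.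
Proof. by rewrite /frac -surjective_pairing reprK. Qed.

Fact frac_surj m : exists x s, m = frac x s.
Proof. by exists (numer m), (denom m); rewrite fracK. Qed.

Let fracKP x s : exists u : den,
  (den_val u * den_val s) .* numer (frac x s) =
  (den_val u * den_val (denom (frac x s))) .* x.
Proof. by apply/fracP; rewrite fracK. Qed.

Let ladd m n :=
  frac (den_val (denom n) .* numer m + den_val (denom m) .* numer n)
       (den_mul (denom m) (denom n)).
Let lopp m := frac (- numer m) (denom m).
Let lzero := frac 0 den_one.

Let laddE x s y t :
  ladd (frac x s) (frac y t) =
  frac (den_val t .* x + den_val s .* y) (den_mul s t).
Proof.
rewrite /ladd; have [u] := fracKP x s; have [v] := fracKP y t.
set y' := numer _; set t' := denom _; set x' := numer _.
set s' := denom _ => ey ex.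
apply/fracP; exists (den_mul u v) => /=; rewrite !scalerDr !rmulA.
congr (_ + _).
  by apply: (rmul_subst (k := den_val v * den_val t * den_val t') ex); ring.
by apply: (rmul_subst (k := den_val u * den_val s * den_val s') ey); ring.
Qed.
Let loppE x s : lopp (frac x s) = frac (- x) s.
Proof.
rewrite /lopp; have [u e] := fracKP x s.
by apply/fracP; exists u; rewrite !scalerN e.
Qed.

Fact frac0 s : frac 0 s = lzero.
Proof. by apply/fracP; exists den_one; rewrite !scaler0. Qed.

Fact laddA : associative ladd.
Proof.
move=> m n o; have [x [s ->]] := frac_surj m; have [y [t ->]] := frac_surj n.
have [z [v ->]] := frac_surj o; rewrite !laddE /= den_mulA.
congr frac; rewrite !scalerDr !rmulA addrA.
by rewrite [den_val v * den_val t]mulrC [den_val v * den_val s]mulrC.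
Qed.
Fact laddC : commutative ladd.
Proof. by move=> m n; rewrite /ladd addrC den_mulC. Qed.
Fact ladd0 : left_id lzero ladd.
Proof.
move=> m; have [x [s ->]] := frac_surj m; rewrite laddE den_mul1.
by rewrite scaler0 add0r rmorph1 scale1r.
Qed.
Fact laddN : left_inverse lzero lopp ladd.
Proof.
move=> m; have [x [s ->]] := frac_surj m.
by rewrite loppE laddE scalerN addNr frac0.
Qed.

HB.instance Definition _ := GRing.isZmodule.Build loc laddA laddC ladd0 laddN.

Fact fracD x s y t :
  frac x s + frac y t = frac (den_val t .* x + den_val s .* y) (den_mul s t).
Proof. exact: laddE. Qed.

Fact frac_cancel u x s : frac (den_val u .* x) (den_mul u s) = frac x s.
Proof.
apply/fracP; exists den_one; rewrite rmulA; congr (alg_map A _ *: _) => /=.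
ring.
Qed.

Fact fracDl x y s : frac x s + frac y s = frac (x + y) s.
Proof. by rewrite fracD -scalerDr frac_cancel. Qed.

End Module.

Section Scale.
Variable M : lmodType A.

Local Notation "r .* x" := (alg_map A r *: x)
  (at level 40, left associativity).

Definition loc_scale (a : loc (A^o)) (m : loc M) : loc M :=
  frac ((numer a : A) *: numer m) (den_mul (denom a) (denom m)).

Let scale2 (a : A) r t (x : M) :
  (r * t) .* (a *: x) = (alg_map A r * a) *: (t .* x).
Proof. by rewrite !scalerA rmorphM -!mulrA [alg_map A t * a]alg_central. Qed.

Let scale_rmul (a : A) r (x : M) : a *: (r .* x) = r .* (a *: x).
Proof. by rewrite !scalerA alg_central. Qed.

Fact loc_scaleE (a : A) s (x : M) t :
  loc_scale (frac (a : A^o) s) (frac x t) = frac (a *: x) (den_mul s t).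
Proof.
have := fracK (frac (a : A^o) s); have := fracK (frac x t); rewrite /loc_scale.
move: (numer (frac x t)) (denom (frac x t)) => x' t' /fracP[u ex].
move: (numer (frac (a : A^o) s)) (denom (frac (a : A^o) s)).
move=> a' s' /fracP[v ea]; apply/fracP; exists (den_mul u v) => /=.
rewrite (_ : _ * (den_val s * _) =
             (den_val v * den_val s) * (den_val u * den_val t));
  last by ring.
rewrite (_ : _ * (den_val s' * _) =
             (den_val v * den_val s') * (den_val u * den_val t'));
  last by ring.
rewrite !scale2 ex; congr (_ *: _); exact: ea.
Qed.

Fact loc_scaleDr a : {morph loc_scale a : m n / m + n}.
Proof.
move=> m n; have [b [s ->]] := frac_surj a; have [x [t ->]] := frac_surj m.
have [y [v ->]] := frac_surj n; rewrite fracD !loc_scaleE fracD /=.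
rewrite -(frac_cancel s); congr frac; last by apply: val_inj => /=; ring.
by rewrite !scalerDr ![b *: (_ *: _)]scale_rmul !rmulA.
Qed.
Fact loc_scaleDl m : {morph loc_scale^~ m : a b / a + b}.
Proof.
move=> a b; have [x [t ->]] := frac_surj m; have [c [s ->]] := frac_surj a.
have [d [v ->]] := frac_surj b; rewrite fracD !loc_scaleE fracD /=.
rewrite -(frac_cancel t); congr frac; last by apply: val_inj => /=; ring.
have reg r (e : A) : ((r .* (e : A^o)) : A) *: x = r .* (e *: x).
  by rewrite scalerA.
rewrite scalerDl !reg scalerDr !rmulA.
by rewrite [den_val t * _]mulrC [den_val t * _]mulrC.
Qed.

Fact loc_scale1 m : loc_scale (frac (1 : A^o) den_one) m = m.
Proof.
by have [x [t ->]] := frac_surj m; rewrite loc_scaleE scale1r den_mul1.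
Qed.
End Scale.

Definition locr : Type := loc (A^o).

HB.instance Definition _ := GRing.Zmodule.on locr.

Let lone : locr := frac (1 : A^o) den_one.
Let lmul (a b : locr) : locr := loc_scale a b.

Fact loc_scaleA (M : lmodType A) a b (m : loc M) :
  loc_scale a (loc_scale b m) = loc_scale (lmul a b) m.
Proof.
have [x [t ->]] := frac_surj m; have [c [s ->]] := frac_surj a.
have [d [v ->]] := frac_surj b.
rewrite /lmul (loc_scaleE d v x t) (loc_scaleE c s (d : A^o) v) !loc_scaleE.
by rewrite scalerA den_mulA.
Qed.

Fact lmulA : associative lmul. Proof. by move=> a b c; apply: loc_scaleA. Qed.
Fact lmul1l : left_id lone lmul. Proof. by move=> a; apply: loc_scale1. Qed.
Fact lmul1r : right_id lone lmul.
Proof.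
move=> a; have [c [s ->]] := frac_surj a.
by rewrite /lmul loc_scaleE den_mulC den_mul1
  -[RHS]/(frac _ _) /GRing.scale /= mulr1.
Qed.
Fact lmulDl : left_distributive lmul +%R.
Proof. by move=> a b c; apply: loc_scaleDl. Qed.
Fact lmulDr : right_distributive lmul +%R.
Proof. by move=> a b c; apply: loc_scaleDr. Qed.

HB.instance Definition _ := GRing.Zmodule_isPzRing.Build locr
  lmulA lmul1l lmul1r lmulDl lmulDr.

HB.instance Definition _ (M : lmodType A) :=
  GRing.Zmodule_isLmodule.Build locr (loc M)
    (@loc_scaleA M) (@loc_scale1 M) (@loc_scaleDr M) (@loc_scaleDl M).

Definition locmap (a : A) : locr := frac (a : A^o) den_one.

Fact locmap_is_additive : zmod_morphism locmap.
Proof.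
move=> a b; apply: (canRL (addrK _)).
by rewrite -[LHS]/(frac _ _ + frac _ _) fracDl subrK.
Qed.
Fact locmap_is_multiplicative : monoid_morphism locmap.
Proof.
split=> // a b.
by rewrite /locmap -[RHS]/(loc_scale _ _) loc_scaleE den_mul1.
Qed.

HB.instance Definition _ := GRing.isZmodMorphism.Build A locr locmap
  locmap_is_additive.
HB.instance Definition _ := GRing.isMonoidMorphism.Build A locr locmap
  locmap_is_multiplicative.

Fact loc_alg_central r a :
  (locmap \o alg_map A) r * a = a * (locmap \o alg_map A) r.
Proof.
have [c [s ->]] := frac_surj a.
rewrite /= /locmap -[LHS]/(loc_scale _ _) -[RHS]/(loc_scale _ _) !loc_scaleE.
by rewrite den_mulC; congr frac; apply: alg_central.
Qed.

Definition locAlg : pzAlg R := PzAlg loc_alg_central.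

End Localization.

(* The balanced map tens : R_p x M -> M_p has the universal property of the
   tensor product R_p (x)_R M, and tens_scale computes the A_p-action on pure
   tensors; for M = A it describes the product of A_p = R_p (x)_R A. *)
Section BaseChange.
Variables (R : comPzRingType) (p : spec R) (A : pzAlg R).

Definition selfAlg : pzAlg R := @PzAlg R R idfun (fun r a => mulrC r a).

Local Notation Rp := (locr p selfAlg).

Definition tens (M : lmodType A) (z : Rp) (x : M) : loc p M :=
  frac (alg_map A (numer z) *: x) (denom z).

Fact tensE (M : lmodType A) (r : R) s (x : M) :
  tens (frac (r : selfAlg^o) s) x = frac (alg_map A r *: x) s.
Proof.
have := fracK (frac (r : selfAlg^o) s); rewrite /tens.
move: (numer _) (denom _) => r' s' /fracP[u e]; apply/fracP; exists u.
by rewrite !rmulA; congr (alg_map A _ *: _).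
Qed.

Fact tensDl (M : lmodType A) (x : M) : {morph @tens M ^~ x : y z / y + z}.
Proof.
move=> y z; have [r [s ->]] := frac_surj y; have [t [v ->]] := frac_surj z.
by rewrite fracD !tensE fracD !rmulA -scalerDl -rmorphD.
Qed.

Fact tensDr (M : lmodType A) z : {morph @tens M z : x y / x + y}.
Proof. by move=> x y; rewrite /tens scalerDr fracDl. Qed.

Let mulE (r t : R) s v : (frac (r : selfAlg^o) s : Rp) * frac (t : selfAlg^o) v
  = frac (r * t : selfAlg^o) (den_mul s v).
Proof. exact: loc_scaleE. Qed.

Fact tens_balanced (M : lmodType A) (z : Rp) (r : R) (x : M) :
  tens (z * locmap p (A := selfAlg) r) x = tens z (alg_map A r *: x).
Proof.
have [t [s ->]] := frac_surj z.
by rewrite mulE !tensE den_mulC den_mul1 rmulA.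
Qed.

Fact tens_scale (M : lmodType A) (z w : Rp) (a : A) (x : M) :
  (tens z (a : A^o) : locr p A) *: tens w x = tens (z * w) (a *: x).
Proof.
have [r [s ->]] := frac_surj z; have [t [v ->]] := frac_surj w.
rewrite mulE !tensE -[LHS]/(loc_scale _ _) loc_scaleE.
congr frac; rewrite !scalerA; congr (_ *: _).
by rewrite rmorphM -!mulrA [alg_map A t * a]alg_central mulrA.
Qed.

Lemma tens_universal (M : lmodType A) (V : zmodType) (b : Rp -> M -> V) :
    (forall x, {morph b^~ x : y z / y + z}) ->
    (forall z, {morph b z : x y / x + y}) ->
    (forall z (r : R) x,
       b (z * locmap p (A := selfAlg) r) x = b z (alg_map A r *: x)) ->
  exists h : {additive loc p M -> V}, (forall z x, h (tens z x) = b z x) /\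
    forall h' : {additive loc p M -> V},
      (forall z x, h' (tens z x) = b z x) -> h' =1 h.
Proof.
move=> bDl bDr bal; pose i s : Rp := frac (1 : selfAlg^o) s.
have iM s t : i (den_mul s t) * locmap p (A := selfAlg) (den_val t) = i s.
  rewrite mulE den_mulC mul1r den_mul1 den_mulC -[RHS](frac_cancel t).
  by congr frac; apply: esym (mulr1 (den_val t)).
have bE r s x : b (frac (r : selfAlg^o) s) x = b (i s) (alg_map A r *: x).
  by rewrite -bal mulE den_mulC den_mul1 mul1r.
pose h0 (m : loc p M) := b (i (denom m)) (numer m).
have h0E x s : h0 (frac x s) = b (i s) x.
  have := fracK (frac x s); rewrite /h0.
  move: (numer _) (denom _) => x' s' /fracP[u e].
  rewrite -(iM s' (den_mul u s)) bal /= e -bal.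
  rewrite (_ : den_mul s' _ = den_mul s (den_mul u s')) ?iM //.
  by apply: val_inj => /=; ring.
have h0_add : zmod_morphism h0.
  have h0D : {morph h0 : m n / m + n}.
    move=> m n; have [x [s ->]] := frac_surj m.
    have [y [t ->]] := frac_surj n; rewrite fracD !h0E bDr -!bal.
    by rewrite iM den_mulC iM.
  by move=> m n; apply: (canRL (addrK _)); rewrite -h0D subrK.
pose hM := GRing.isZmodMorphism.Build _ _ h0 h0_add.
pose h : {additive loc p M -> V} := HB.pack h0 hM.
exists h; split=> [z x|h' h'E m].
  have [r [s ->]] := frac_surj z; rewrite tensE bE; exact: h0E.
have [x [s ->]] := frac_surj m; rewrite [RHS]h0E -h'E tensE.
by rewrite rmorph1 scale1r.
Qed.

End BaseChange.

Section IdealMod.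
Variables (R : comPzRingType) (A : pzAlg R) (p : spec R) (M : lmodType A).

Definition idealmod_set : set M := [set x | exists s : seq (R * M),
  (forall a, a \in s -> (p : set R) a.1) /\
  x = \sum_(a <- s) alg_map A a.1 *: a.2].

Fact idealmod0 : idealmod_set 0.
Proof. by exists [::]; split=> //; rewrite big_nil. Qed.
Fact idealmodD x y : idealmod_set x -> idealmod_set y -> idealmod_set (x + y).
Proof.
move=> [s [sp ->]] [t [tp ->]]; exists (s ++ t); split; last by rewrite big_cat.
by move=> a; rewrite mem_cat => /orP[/sp|/tp].
Qed.
Fact idealmodZ a x : idealmod_set x -> idealmod_set (a *: x).
Proof.
move=> [s [sp ->]]; exists [seq (b.1, a *: b.2) | b <- s]; split.
  by move=> _ /mapP[b /sp pb ->].
rewrite big_map scaler_sumr; apply: eq_bigr => b _ /=.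
by rewrite !scalerA alg_central.
Qed.

Definition idealmod : submod M := Submod idealmod0 idealmodD idealmodZ.

End IdealMod.

(* Full subcategories of Mod A.  These are predicates rather than
   classical sets in order to avoid universe constraints. *)
Definition modclass (A : pzRingType) := lmodType A -> Prop.

Definition subclass (A : pzRingType) (C D : modclass A) : Prop :=
  forall M, C M -> D M.

(* Torsion classes of the full abelian subcategory of Mod A on C, where C is
   closed under isomorphisms and exact sequences in C are those of Mod A. *)
Record is_torsion (A : pzRingType) (C T : modclass A) : Prop := IsTorsion {
  torsion_sub : subclass T C;
  torsion_zero : forall M : lmodType A, (forall x : M, x = 0) -> T M;
  torsion_isom : forall M N, T M -> isom M N -> T N;
  torsion_ext : forall (M N P : lmodType A) (f : {linear M -> N})
    (g : {linear N -> P}), short_exact f g -> C N -> T M -> T P -> T N;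
  torsion_quot : forall (M N : lmodType A) (f : {linear M -> N}),
    (forall y, exists x, f x = y) -> C N -> T M -> T N }.

Record tors (A : pzRingType) (C : modclass A) := Tors {
  tors_class :> modclass A;
  torsP : is_torsion C tors_class }.

Definition tors_le A C (T U : @tors A C) : Prop := subclass T U.

Fact tors_le_anti A C (T U : @tors A C) : tors_le T U -> tors_le U T -> T = U.
Proof.
case: T U => [T hT] [U hU] TU UT.
have e : T = U.
  by apply: funext => M; apply: propext; split; [apply: TU|apply: UT].
by case: U / e hU {TU UT} => hU; congr Tors; apply: Prop_irrelevance.
Qed.

Definition order_embedding (S T : Type) (leS : S -> S -> Prop)
    (leT : T -> T -> Prop) (f : S -> T) : Prop :=
  (forall a b, leS a b -> leT (f a) (f b)) /\
  (forall a b, leT (f a) (f b) -> leS a b).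

Definition noetherian_algebra (R : comPzRingType) (L : pzAlg R) : Prop :=
  noetherian R /\ fingen (restr (alg_map L) (L^o)).

Section Main.
Variables (R : comPzRingType) (L : pzAlg R).

Local Notation "L_( p )" := (locAlg p L) (at level 0, format "L_( p )").

Definition locClass (p : spec R) (C : modclass L) : modclass L_(p) :=
  fun N => exists2 M : lmodType L, C M & isom N (loc p M).

Arguments locClass p C N : clear implicits.

Definition psi (p : spec R) (C : modclass L_(p)) : modclass L_(p) :=
  fun M => fingen M /\ C (qmod (idealmod p M)).

Arguments psi p C M : clear implicits.

(* For q contained in p, the localization M_q of an L_p-module M is
   R_q (x)_R M, i.e. the localization of M viewed as an L-module. *)
Definition relocClass (p q : spec R) (C : modclass L_(p)) : modclass L_(q) :=
  fun N => exists2 M : lmodType L_(p), C M &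
    isom N (loc q (restr (locmap p (A := L)) M)).

Arguments relocClass p q C N : clear implicits.

Definition rmap (p q : spec R) (C : modclass L_(p)) : modclass L_(q) :=
  fun N => relocClass p q (psi p C) N /\ finlen N.

Arguments rmap p q C N : clear implicits.

Definition torsL := tors (@fingen L).

Definition TR := forall p : spec R, tors (@finlen L_(p)).

Definition TR_le (X Y : TR) : Prop := forall p, tors_le (X p) (Y p).

Definition compatible (X : TR) : Prop :=
  forall p q : spec R, (q : set R) `<=` p -> subclass (X q) (rmap p q (X p)).

Definition TcR := {X : TR | compatible X}.

Definition TcR_le (X Y : TcR) : Prop := TR_le (sval X) (sval Y).

End Main.

Arguments locClass {R L} p C N.
Arguments psi {R L} p C M.
Arguments relocClass {R L} p q C N.
Arguments rmap {R L} p q C N.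

(* Main.v *)
From HB Require Import structures.
From mathcomp Require Import all_boot all_order all_algebra.
From mathcomp Require Import ring boolp classical_sets.
Require Import Defs.

(* Writing tr_T for the sum of the submodules lying in T, a finitely generated
   module N over the localization of Lambda at p lies in T_p iff tr_T N = N,
   where N is viewed as a Lambda-module.

   Compatibility: if X is in T, then X_p / pX_p is a finitely generated module
   over the residue field tensored with Lambda, hence of finite length, and
   (X_p)_q = X_q.

   Order reflection: suppose Phi(T) <= Phi(U) and X is in T but not in U.  By
   noetherianity X has a quotient Y outside U all of whose proper quotients are
   in U.  Then each r in R acts on Y by zero or injectively (otherwise rY and
   Y/rY are both in U), so the annihilator p of Y is prime, Y embeds in Y_p, and
   Y_p has finite length.  Hence Y_p is in U_p, so some Z in U maps to Y_p with
   nonzero image in Y after clearing denominators; this image and the quotient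
   of Y by it are in U, a contradiction. *)

Set Implicit Arguments.
Unset Strict Implicit.
Unset Printing Implicit Defensive.

Import GRing.Theory.
Local Open Scope ring_scope.
Local Open Scope classical_set_scope.

Local Notation "x ∈ N" := (submod_set N x) (at level 70, no associativity).

(** * Submodules, spans and finite generation *)

Section LinearMaps.
Variables (A : pzRingType) (M N : lmodType A).

Definition mkLinear (f : M -> N) (f_lin : linear f) : {linear M -> N} :=
  HB.pack f (GRing.isLinear.Build A M N *:%R f f_lin).

Lemma linear_inv (f : {linear M -> N}) (g : N -> M) :
  cancel f g -> cancel g f -> linear g.
Proof. by move=> fK gK a x y; rewrite -{1}(gK x) -{1}(gK y) -linearP fK. Qed.

End LinearMaps.

Lemma isom_sym (A : pzRingType) (M N : lmodType A) : isom M N -> isom N M.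
Proof.
case=> f [g fK gK]; exists (mkLinear (linear_inv fK gK)).
by exists f.
Qed.

Definition restrLinear (A B : pzRingType) (h : {rmorphism A -> B})
    (M N : lmodType B) (f : {linear M -> N}) :
    {linear restr h M -> restr h N} :=
  mkLinear (f := f : restr h M -> restr h N)
    (fun a x y => linearP f (h a) x y).

Section Submodules.
Variables (A : pzRingType) (M : lmodType A).
Implicit Types N Z : submod M.

Lemma submodN N x : x ∈ N -> - x ∈ N.
Proof. by rewrite -scaleN1r; apply: submodZ. Qed.

Lemma submodB N x y : x ∈ N -> y ∈ N -> x - y ∈ N.
Proof. by move=> Nx Ny; apply: submodD => //; apply: submodN. Qed.

Lemma submod_sum N (I : Type) (r : seq I) (P : pred I) (F : I -> M) :
  (forall i, P i -> F i ∈ N) -> \sum_(i <- r | P i) F i ∈ N.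
Proof.
move=> NF; apply: (big_ind (submod_set N)) => //; first exact: submod0.
exact: submodD.
Qed.

(** Torsion classes are predicates on modules, so a submodule has to become a module in its own
    right. The subtype construction needs a boolean predicate, obtained classically. *)
Definition smod_pred N : {pred M} := fun x => `[< x ∈ N >].

Definition smod N : Type := {x : M | smod_pred N x}.

Section Smod.
Variable N : submod M.
HB.instance Definition _ := SubChoice.on (smod N).

Fact smod_closed : subsemimod_closed (smod_pred N).
Proof.
split; first split.
- by apply/asboolP; apply: submod0.
- by move=> x y /asboolP Nx /asboolP Ny; apply/asboolP; apply: submodD.
- by move=> a x /asboolP Nx; apply/asboolP; apply: submodZ.
Qed.

HB.instance Definition _ :=
  GRing.SubChoice_isSubLmodule.Build A M (smod_pred N) (smod N) smod_closed.

Definition smod_val : {linear smod N -> M} := val.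

Lemma smod_valP (x : smod N) : smod_val x ∈ N.
Proof. by apply/asboolP; apply: (valP x). Qed.

Lemma smod_val_inj : injective smod_val.
Proof. exact: val_inj. Qed.

Lemma smod_ex x : x ∈ N -> exists y : smod N, smod_val y = x.
Proof. by move=> /asboolP Nx; exists (Sub x Nx); apply: SubK. Qed.

End Smod.

Fact zerosubD (x y : M) : x = 0 -> y = 0 -> x + y = 0.
Proof. by move=> -> ->; rewrite addr0. Qed.
Fact zerosubZ a (x : M) : x = 0 -> a *: x = 0.
Proof. by move=> ->; rewrite scaler0. Qed.

Definition zerosub : submod M := @Submod A M [set 0] erefl zerosubD zerosubZ.

Definition subT : submod M := @Submod A M setT I (fun _ _ _ _ => I)
  (fun _ _ _ => I).

End Submodules.

Arguments smod_val {A M N} : simpl never.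

Section Corestriction.
Variables (A : pzRingType) (M N : lmodType A) (f : {linear M -> N}).
Variables (Z : submod N) (fZ : forall x, f x ∈ Z).

Definition corestr_fun (x : M) : smod Z := sval (cid (smod_ex (fZ x))).

Lemma corestr_funE x : smod_val (corestr_fun x) = f x.
Proof. by rewrite /corestr_fun; case: cid. Qed.

Lemma corestr_fun_linear : linear corestr_fun.
Proof.
move=> a x y; apply: smod_val_inj.
by rewrite linearP !corestr_funE linearP.
Qed.

Definition corestr : {linear M -> smod Z} := mkLinear corestr_fun_linear.

Lemma corestrE x : smod_val (corestr x) = f x.
Proof. exact: corestr_funE. Qed.

End Corestriction.

Section Images.
Variables (A : pzRingType) (M N : lmodType A) (f : {linear M -> N}).

Section Preim.
Variable Z : submod N.

Fact preimsub0 : f 0 ∈ Z.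
Proof. by rewrite linear0; apply: submod0. Qed.
Fact preimsubD x y : f x ∈ Z -> f y ∈ Z -> f (x + y) ∈ Z.
Proof. by rewrite linearD; apply: submodD. Qed.
Fact preimsubZ a x : f x ∈ Z -> f (a *: x) ∈ Z.
Proof. by rewrite linearZ; apply: submodZ. Qed.

Definition preimsub : submod M :=
  @Submod A M [set x | f x ∈ Z] preimsub0 preimsubD preimsubZ.
End Preim.

Definition kersub : submod M := preimsub (zerosub N).

Section Im.
Variable Z : submod M.

Fact imsub0 : (f @` Z) 0.
Proof. by exists 0; [apply: submod0|rewrite linear0]. Qed.
Fact imsubD x y : (f @` Z) x -> (f @` Z) y -> (f @` Z) (x + y).
Proof.
by move=> [u Zu <-] [v Zv <-]; exists (u + v); [apply: submodD|rewrite linearD].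
Qed.
Fact imsubZ a x : (f @` Z) x -> (f @` Z) (a *: x).
Proof.
by move=> [u Zu <-]; exists (a *: u); [apply: submodZ|rewrite linearZ].
Qed.

Definition imsub : submod N := Submod imsub0 imsubD imsubZ.
End Im.

End Images.

Section Sum.
Variables (A : pzRingType) (M : lmodType A) (Z W : submod M).

Definition sumsub_set : set M :=
  [set x | exists z w, [/\ z ∈ Z, w ∈ W & x = z + w]].

Fact sumsub0 : sumsub_set 0.
Proof. by exists 0, 0; rewrite addr0; split=> //; apply: submod0. Qed.
Fact sumsubD x y : sumsub_set x -> sumsub_set y -> sumsub_set (x + y).
Proof.
move=> [z [w [Zz Ww ->]]] [z' [w' [Zz' Ww' ->]]]; exists (z + z'), (w + w').
by rewrite addrACA; split=> //; apply: submodD.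
Qed.
Fact sumsubZ a x : sumsub_set x -> sumsub_set (a *: x).
Proof.
move=> [z [w [Zz Ww ->]]]; exists (a *: z), (a *: w).
by rewrite scalerDr; split=> //; apply: submodZ.
Qed.

Definition sumsub : submod M := Submod sumsub0 sumsubD sumsubZ.

Lemma sumsubl x : x ∈ Z -> x ∈ sumsub.
Proof. by exists x, 0; rewrite addr0; split=> //; apply: submod0. Qed.
Lemma sumsubr x : x ∈ W -> x ∈ sumsub.
Proof. by exists 0, x; rewrite add0r; split=> //; apply: submod0. Qed.

End Sum.

Section Span.
Variables (A : pzRingType) (M : lmodType A).

Section Def.
Variables (n : nat) (g : 'I_n -> M).

Definition span_set : set M :=
  [set x | exists c : 'I_n -> A, x = \sum_i c i *: g i].

Fact span0 : span_set 0.
Proof. by exists (fun=> 0); rewrite big1 // => i _; rewrite scale0r. Qed.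
Fact spanD x y : span_set x -> span_set y -> span_set (x + y).
Proof.
move=> [c ->] [d ->]; exists (fun i => c i + d i); rewrite -big_split.
by apply: eq_bigr => i _; rewrite scalerDl.
Qed.
Fact spanZ a x : span_set x -> span_set (a *: x).
Proof.
move=> [c ->]; exists (fun i => a * c i); rewrite scaler_sumr.
by apply: eq_bigr => i _; rewrite scalerA.
Qed.

Definition spansub : submod M := Submod span0 spanD spanZ.

Lemma mem_span i : g i ∈ spansub.
Proof.
exists (fun j => (j == i)%:R).
rewrite (bigD1 i) //= eqxx scale1r big1 ?addr0 //.
by move=> j /negPf ->; rewrite scale0r.
Qed.

Lemma span_min (N : submod M) : (forall i, g i ∈ N) -> spansub `<=` N.
Proof.
by move=> Ng _ [c ->]; apply: submod_sum => i _; apply: submodZ.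
Qed.
End Def.

Definition gcat m n (g : 'I_m -> M) (h : 'I_n -> M) (i : 'I_(m + n)) : M :=
  match split i with inl j => g j | inr j => h j end.

Lemma gcat_lshift m n (g : 'I_m -> M) (h : 'I_n -> M) i :
  gcat g h (lshift n i) = g i.
Proof. by rewrite /gcat (unsplitK (inl i)). Qed.

Lemma gcat_rshift m n (g : 'I_m -> M) (h : 'I_n -> M) i :
  gcat g h (rshift m i) = h i.
Proof. by rewrite /gcat (unsplitK (inr i)). Qed.

Lemma gcatP m n (g : 'I_m -> M) (h : 'I_n -> M) (P : M -> Prop) :
  (forall i, P (g i)) -> (forall i, P (h i)) -> forall i, P (gcat g h i).
Proof. by move=> Pg Ph i; rewrite /gcat; case: split. Qed.

Lemma span_catl m n (g : 'I_m -> M) (h : 'I_n -> M) :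
  spansub g `<=` spansub (gcat g h).
Proof.
by apply: span_min => i; rewrite -(gcat_lshift g h); apply: mem_span.
Qed.

Lemma span_catr m n (g : 'I_m -> M) (h : 'I_n -> M) :
  spansub h `<=` spansub (gcat g h).
Proof.
by apply: span_min => i; rewrite -(gcat_rshift g h); apply: mem_span.
Qed.

(** The generators are taken in [S] itself, so finite generation of a submodule can be discussed
    inside [M]; [fingen_smod] translates. *)
Definition fgset (S : set M) : Prop := exists (n : nat) (g : 'I_n -> M),
  (forall i, S (g i)) /\ S `<=` spansub g.

End Span.

Lemma span_image (A : pzRingType) (M N : lmodType A) (f : {linear M -> N}) n
  (g : 'I_n -> M) x : x ∈ spansub g -> f x ∈ spansub (f \o g).
Proof.
move=> [c ->]; exists c; rewrite linear_sum.
by apply: eq_bigr => i _; rewrite linearZ.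
Qed.

Lemma fingen_image (A : pzRingType) (M N : lmodType A) (f : {linear M -> N}) :
  (forall y, exists x, f x = y) -> fingen M -> fingen N.
Proof.
move=> fS [n [g gM]]; exists n, (f \o g) => y; have [x <-] := fS y.
exact/span_image/gM.
Qed.

Lemma fingen_ext (A : pzRingType) (M N P : lmodType A) (f : {linear M -> N})
  (g : {linear N -> P}) : short_exact f g -> fingen M -> fingen P -> fingen N.
Proof.
move=> [_ ker_g gS] [m [x xM]] [n [y yP]].
have /choice[z zy] : forall i, exists z, g z = y i by move=> i; apply: gS.
exists (m + n)%N, (gcat (f \o x) z) => w.
have [c gw] := yP (g w); pose w' := \sum_i c i *: z i.
have /ker_g[v fv] : g (w - w') = 0.
  rewrite linearB gw linear_sum -sumrB big1 // => i _.
  by rewrite linearZ zy subrr.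
rewrite -(subrK w' w) -fv; apply: (submodD (s := spansub _)).
  exact/span_catl/span_image/xM.
by apply: span_catr; exists c.
Qed.

Lemma fingen_smod (A : pzRingType) (M : lmodType A) (Z : submod M) :
  fgset Z <-> fingen (smod Z).
Proof.
split=> [[n [g [gZ Zg]]]|[n [g gP]]].
  have /choice[h hg] : forall i, exists y : smod Z, smod_val y = g i.
    by move=> i; apply: smod_ex.
  exists n, h => x; have [c e] := Zg _ (smod_valP x); exists c.
  apply: smod_val_inj; rewrite e linear_sum.
  by apply: eq_bigr => i _; rewrite linearZ hg.
exists n, (fun i => smod_val (g i)); split=> [i|x Zx]; first exact: smod_valP.
have [y <-] := smod_ex Zx; exact: (span_image smod_val (gP y)).
Qed.

(** * Noetherian algebras *)

Section Cap.
Variables (A : pzRingType) (M : lmodType A) (Z W : submod M).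

Fact capsub0 : 0 ∈ Z /\ 0 ∈ W. Proof. by split; apply: submod0. Qed.
Fact capsubD x y : x ∈ Z /\ x ∈ W -> y ∈ Z /\ y ∈ W -> x + y ∈ Z /\ x + y ∈ W.
Proof. by move=> [Zx Wx] [Zy Wy]; split; apply: submodD. Qed.
Fact capsubZ a x : x ∈ Z /\ x ∈ W -> a *: x ∈ Z /\ a *: x ∈ W.
Proof. by move=> [Zx Wx]; split; apply: submodZ. Qed.

Definition capsub : submod M :=
  @Submod A M [set x | x ∈ Z /\ x ∈ W] capsub0 capsubD capsubZ.
End Cap.

(** Induction on the number of generators of the ambient span. The [g i] may satisfy relations, so
    an element has several possible coefficients at the first one; those arising from [S] form an
    ideal, and the part of [S] in the span of the others falls under the induction hypothesis. *)
Lemma noetherian_fgset (R : comPzRingType) (M : lmodType R) n (g : 'I_n -> M)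
    (S : submod M) :
  noetherian R -> (forall x, x ∈ S -> x ∈ spansub g) -> fgset S.
Proof.
move=> noeR; elim: n g S => [|n IHn] g S Sg.
  by exists 0%N, g; split=> // -[].
pose g' i := g (lift ord0 i).
(* The ideal of coefficients at g_0 of elements of S. *)
pose I : set R := [set r | exists2 x, x ∈ S & x - r *: g ord0 ∈ spansub g'].
have idI : ideal I.
  split=> [|r s [x Sx xr] [y Sy ys]|a r [x Sx xr]].
  - by exists 0; [apply: submod0|rewrite scale0r subr0; apply: submod0].
  - exists (x + y); first exact: submodD.
    by rewrite scalerDl opprD addrACA; apply: submodD.
  - exists (a *: x); first exact: submodZ.
    by rewrite -scalerA -scalerBr; apply: submodZ.
have [k [r [Ir rI]]] := noeR I idI.
have /choice[x xP] : forall j, exists x,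
    x ∈ S /\ x - r j *: g ord0 ∈ spansub g'.
  by move=> j; have [x] := Ir j; exists x.
have [m [y [Sy yS]]] := IHn g' (capsub S (spansub g')) (fun x => @proj2 _ _).
exists (k + m)%N, (gcat x y); split=> [|w Sw].
  by apply: gcatP => i; [case: (xP i)|case: (Sy i)].
have [c wE] := Sg _ Sw; rewrite big_ord_recl in wE.
have [|d cE] := rI (c ord0).
  exists w => //; rewrite wE addrC addKr.
  by exists (fun i => c (lift ord0 i)).
(* [w] and the combination of the [x j] share the coefficient [c ord0], so their difference lies in
   [S] and in the span of [g'], where the [y] generate. *)
rewrite -(subrK (\sum_j d j *: x j) w); apply: (submodD (s := spansub _)).
  apply: span_catr; apply: yS; split.
    apply: submodB => //; apply: submod_sum => i _; apply: submodZ.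
    by case: (xP i).
  have -> : w - \sum_j d j *: x j = (w - c ord0 *: g ord0)
      - \sum_j d j *: (x j - r j *: g ord0).
    under [in RHS]eq_bigr do rewrite scalerBr scalerA.
    by rewrite sumrB -scaler_suml -cE opprB addrA subrK.
  apply: (submodB (N := spansub _)).
    by rewrite wE addrC addKr; exists (fun i => c (lift ord0 i)).
  apply: (submod_sum (N := spansub _)) => j _.
  by apply: (submodZ (s := spansub _)); case: (xP j).
by apply: span_catl; exists d.
Qed.

Lemma span_fintype (A : pzRingType) (M : lmodType A) (I : finType)
    (h : I -> M) :
  exists n (g : 'I_n -> M), forall c : I -> A, \sum_i c i *: h i ∈ spansub g.
Proof.
exists #|I|, (h \o enum_val) => c; exists (c \o enum_val).
by rewrite big_enum_val.
Qed.

Section NoetherianAlgebra.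
Variables (R : comPzRingType) (L : pzAlg R).
Hypothesis noeL : noetherian_algebra L.

(** If the [e j] generate [L] over [R], the products [e j *: g i] span over [R] whatever the [g i]
    span over [L]. *)
Lemma span_restr (M : lmodType L) n (g : 'I_n -> M) :
  exists m (h : 'I_m -> restr (alg_map L) M),
    forall x, x ∈ spansub g -> (x : restr (alg_map L) M) ∈ spansub h.
Proof.
have [_ [k [e eP]]] := noeL.
pose eg i j : restr (alg_map L) M := (e j : L) *: g i.
have [m [h hP]] := span_fintype (fun ij => eg ij.1 ij.2).
exists m, h => _ [c ->].
have /choice[d dP] : forall i, exists d : 'I_k -> R,
    c i = \sum_j d j *: (e j : restr (alg_map L) (L^o)) by move=> i; apply: eP.
have -> : \sum_i c i *: g i =
    \sum_(ij : 'I_n * 'I_k) d ij.1 ij.2 *: eg ij.1 ij.2.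
  rewrite -(pair_bigA _ (fun i j => d i j *: eg i j)) /=.
  apply: eq_bigr => i _; rewrite dP scaler_suml; apply: eq_bigr => j _.
  by rewrite [RHS]scalerA.
apply: (hP (fun ij => d ij.1 ij.2)).
Qed.

Lemma fingen_restr (M : lmodType L) :
  fingen M -> fingen (restr (alg_map L) M).
Proof.
move=> [n [g gM]]; have [m [h hP]] := span_restr g.
by exists m, h => x; apply: hP; apply: gM.
Qed.

(** Over [R] the statement is [noetherian_fgset], and generators over [R] also generate over [L]. *)
Lemma noetherian_alg_fgset (M : lmodType L) n (g : 'I_n -> M) (S : submod M) :
  (forall x, x ∈ S -> x ∈ spansub g) -> fgset S.
Proof.
have [m [h hP]] := span_restr g => Sg.
pose S' : submod (restr (alg_map L) M) := @Submod _ (restr (alg_map L) M)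
  (submod_set S) (submod0 S) (@submodD _ _ S) (fun a x => @submodZ _ _ S _ x).
have [||k [e [Se eS]]] := @noetherian_fgset _ _ _ h S'.
- by case: noeL.
- by move=> x /Sg/hP.
exists k, e; split=> // x /eS[c ->].
by exists (fun i => alg_map L (c i)).
Qed.

End NoetherianAlgebra.

(** * Torsion classes and traces *)

Section TorsionClasses.
Variables (A : pzRingType) (T : tors (@fingen A)).

Lemma tors_fingen M : tors_class T M -> fingen M.
Proof. exact: torsion_sub (torsP T) M. Qed.

Lemma tors_image (M N : lmodType A) (f : {linear M -> N}) :
  (forall y, exists x, f x = y) -> tors_class T M -> tors_class T N.
Proof.
move=> fS TM; apply: (torsion_quot (torsP T) fS) => //.
exact/(fingen_image fS)/tors_fingen.
Qed.

Lemma tors_extension (M N P : lmodType A) (f : {linear M -> N})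
    (g : {linear N -> P}) :
  short_exact f g -> tors_class T M -> tors_class T P -> tors_class T N.
Proof.
move=> fg TM TP; apply: (torsion_ext (torsP T) fg) => //.
by apply: (fingen_ext fg); apply: tors_fingen.
Qed.

Lemma tors_imsub (M N : lmodType A) (f : {linear M -> N}) (Z : submod M) :
  tors_class T (smod Z) -> tors_class T (smod (imsub f Z)).
Proof.
have fZ (x : smod Z) : (f \o smod_val) x ∈ imsub f Z.
  by exists (smod_val x) => //; apply: smod_valP.
apply: (tors_image (f := corestr fZ)) => y.
have [x Zx fx] := smod_valP y; have [z zx] := smod_ex Zx.
by exists z; apply: smod_val_inj; rewrite corestrE -[LHS]/(f (smod_val z)) zx.
Qed.

Lemma tors_subT (M : lmodType A) :
  tors_class T M -> tors_class T (smod (subT M)).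
Proof.
have idT (x : M) : (idfun : {linear M -> M}) x ∈ subT M by [].
apply: (tors_image (f := corestr idT)) => y; exists (smod_val y).
by apply: smod_val_inj; rewrite corestrE.
Qed.

Lemma tors_range (M N : lmodType A) (f : {linear M -> N}) :
  tors_class T M -> tors_class T (smod (imsub f (subT M))).
Proof. by move=> /tors_subT/tors_imsub; apply. Qed.

(** The sequence 0 -> Z -> W -> Q -> 0 is described inside the ambient [N] and [P], so that later
    uses need no maps between subtypes. *)
Lemma tors_sub_extension (N P : lmodType A) (g : {linear N -> P})
    (Z W : submod N) (Q : submod P) :
    (forall x, x ∈ Z <-> x ∈ W /\ g x = 0) ->
    imsub g W = Q :> set P ->
  tors_class T (smod Z) -> tors_class T (smod Q) -> tors_class T (smod W).
Proof.
move=> ZW WQ.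
have Z_W (x : smod Z) : smod_val x ∈ W by have /ZW[] := smod_valP x.
have gWQ (x : smod W) : (g \o smod_val) x ∈ Q.
  by rewrite -WQ; exists (smod_val x) => //; apply: smod_valP.
apply: (tors_extension (f := corestr Z_W) (g := corestr gWQ)); split.
- move=> x y /(congr1 smod_val); rewrite !corestrE; exact: smod_val_inj.
- move=> y; split=> [/(congr1 smod_val)|[x <-]].
    rewrite corestrE linear0 => gy.
    have [|x xy] := @smod_ex _ _ Z (smod_val y).
      by apply/ZW; split=> //; apply: smod_valP.
    by exists x; apply: smod_val_inj; rewrite corestrE.
  apply: smod_val_inj.
  rewrite corestrE -[LHS]/(g (smod_val (corestr Z_W x))) corestrE linear0.
  by have /ZW[] := smod_valP x.
- move=> z; have := smod_valP z; rewrite -WQ => -[x Wx gx].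
  have [y yx] := smod_ex Wx; exists y; apply: smod_val_inj.
  by rewrite corestrE -[LHS]/(g (smod_val y)) yx.
Qed.

(** [Z + W] modulo [Z] is the image of [W] in [M / Z], hence a factor of [W]. *)
Lemma tors_sumsub (M : lmodType A) (Z W : submod M) :
  tors_class T (smod Z) -> tors_class T (smod W) ->
  tors_class T (smod (sumsub Z W)).
Proof.
move=> TZ TW; apply: (tors_sub_extension (g := qproj Z) (Z := Z)
  (Q := imsub (qproj Z) W)) => //; last exact: tors_imsub.
  have qZ x : qproj Z x = 0 <-> x ∈ Z.
    by rewrite -(linear0 (qproj Z)) qprojP subr0.
  move=> x; split=> [Zx|[_ /qZ]//]; split; last exact/qZ.
  exact: sumsubl.
apply/seteqP; split=> y [x]; last first.
  by move=> Wx <-; exists x => //; apply: sumsubr.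
move=> [z [w [Zz Ww ->]]] <-; exists w => //; apply/qprojP.
by rewrite opprD addrCA subrr addr0; apply: submodN.
Qed.

(** Membership in the trace of [T]: by [tors_sumsub] the union of the submodules in [T] is already
    their sum. *)
Definition in_trace (N : lmodType A) (y : N) : Prop :=
  exists2 Z : submod N, tors_class T (smod Z) & y ∈ Z.

Lemma trace_range (M N : lmodType A) (f : {linear M -> N}) x :
  tors_class T M -> in_trace (f x).
Proof.
by move=> TM; exists (imsub f (subT M)); [apply: tors_range|exists x].
Qed.

Lemma trace_image (M N : lmodType A) (f : {linear M -> N}) x :
  in_trace x -> in_trace (f x).
Proof.
by move=> [Z TZ Zx]; exists (imsub f Z); [apply: tors_imsub|exists x].
Qed.

Lemma traceD (N : lmodType A) (x y : N) :
  in_trace x -> in_trace y -> in_trace (x + y).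
Proof.
move=> [Z TZ Zx] [W TW Wy]; exists (sumsub Z W); first exact: tors_sumsub.
by exists x, y.
Qed.

Lemma tors_zerosub (N : lmodType A) : tors_class T (smod (zerosub N)).
Proof.
apply: (torsion_zero (torsP T)) => x; apply: smod_val_inj.
by rewrite linear0; exact: (smod_valP x).
Qed.

Lemma trace0 (N : lmodType A) : in_trace (0 : N).
Proof. by exists (zerosub N); first exact: tors_zerosub. Qed.

(** Adding up submodules absorbs the elements one by one. This turns an elementwise trace condition
    back into a single member of [T]. *)
Lemma trace_family (N : lmodType A) n (g : 'I_n -> N) :
  (forall i, in_trace (g i)) ->
  exists2 Z : submod N, tors_class T (smod Z) & forall i, g i ∈ Z.
Proof.
elim: n g => [|n IHn] g tg.
  by have [Z] := trace0 N; exists Z => // -[].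
have [Z TZ Zg0] := tg ord0.
have [W TW Wg] := IHn (fun i => g (lift ord0 i)) (fun i => tg _).
exists (sumsub Z W); first exact: tors_sumsub.
move=> i; case: (unliftP ord0 i) => [j|] ->; last exact: sumsubl.
exact/sumsubr/Wg.
Qed.

End TorsionClasses.

(** * Maximal submodules and minimal quotients *)

Lemma maximal_submod (A : pzRingType) (M : lmodType A) (P : submod M -> Prop)
    (W0 : submod M) :
  (forall S : submod M, fgset S) -> P W0 ->
  exists2 W, P W & forall V, P V -> (forall x, x ∈ W -> x ∈ V) ->
    forall x, x ∈ V -> x ∈ W.
Proof.
move=> noeM PW0; apply: contrapT => noW.
(* Without a maximal element every [W] has a strictly larger successor, and iterating a choice of
   successors gives the increasing chain [F]. *)
have /choice[next nextP] : forall W : {W | P W}, exists V : {V | P V},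
    (forall x, x ∈ sval W -> x ∈ sval V) /\
    exists2 x, x ∈ sval V & ~ x ∈ sval W.
  move=> [W PW]; apply: contrapT => noV; apply: noW.
  exists W => // V PV WV x Vx.
  apply: contrapT => Wx; apply: noV; exists (exist _ V PV).
  by split=> //; exists x.
pose F n := iter n next (exist _ W0 PW0).
have Fmono m n x : x ∈ sval (F m) -> x ∈ sval (F (m + n)%N).
  by elim: n => [|n IHn]; rewrite ?addn0 // addnS => /IHn; apply: (nextP _).1.
pose S : set M := [set x | exists n, x ∈ sval (F n)].
have S0 : S 0 by exists 0%N; apply: submod0.
have SD x y : S x -> S y -> S (x + y).
  move=> [m Fx] [n Fy]; exists (m + n)%N; apply: submodD; first exact: Fmono.
  by rewrite addnC; apply: Fmono.
have SZ a x : S x -> S (a *: x) by move=> [m Fx]; exists m; apply: submodZ.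
have [n [g [/choice[k kP] Sg]]] := noeM (Submod S0 SD SZ).
(* The finitely many generators of the union all lie in [F K], so [F K.+1] cannot be strictly
   larger. *)
pose K := \max_i k i.
have [x Fx nFx] := (nextP (F K)).2; apply: nFx.
have : x ∈ spansub g by apply: Sg; exists K.+1.
apply: span_min => i.
by rewrite /K -(subnKC (leq_bigmax i)); apply: Fmono.
Qed.

(** Divide [X] by a submodule that is maximal among the kernels of quotients outside [U]; a further
    proper quotient has a strictly larger kernel in [X]. *)
Lemma minimal_quotient_outside (A : pzRingType) (U : tors (@fingen A))
    (X : lmodType A) :
  (forall S : submod X, fgset S) -> ~ tors_class U X ->
  exists (Y : lmodType A) (f : {linear X -> Y}),
  [/\ forall y, exists x, f x = y, ~ tors_class U Y &
    forall (Y' : lmodType A) (g : {linear Y -> Y'}),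
      (forall z, exists y, g y = z) -> (exists2 y, y <> 0 & g y = 0) ->
      tors_class U Y'].
Proof.
move=> noeX UX.
pose P (W : submod X) := exists (Y : lmodType A) (f : {linear X -> Y}),
  [/\ forall y, exists x, f x = y, forall x, f x = 0 <-> x ∈ W
    & ~ tors_class U Y].
have [|W [Y [f [fS ker_f UY]]] Wmax] := @maximal_submod _ _ P (zerosub X) noeX.
  by exists X, idfun; split=> // y; exists y.
exists Y, f; split=> // Y' g gS [y y0 gy]; apply: contrapT => UY'.
have [x fx] := fS y; case: y0; rewrite -fx; apply/ker_f.
(* If [Y'] were outside [U], the kernel of [g \o f] would compete with [W]; it contains [W] and also
   [x]. *)
apply: (Wmax (kersub (g \o f))).
- exists Y', (g \o f); split=> // z.
  by have [v <-] := gS z; have [x' <-] := fS v; exists x'.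
- by move=> x' /ker_f fx'; apply: etrans (linear0 g); rewrite -fx'.
- by change (g (f x) = 0); rewrite fx.
Qed.

(** * Localization *)

Section Localization.
Variables (R : comPzRingType) (L : pzAlg R) (p : spec R).
Implicit Types (r : R) (s t : den p) (a : L).

Local Notation Lp := (locAlg p L).

(** The fraction 1/s, inverse to the image of [s] and commuting with the image of [L]. *)
Definition linv s : locr p L := frac (1 : L^o) s.

Lemma locmap_frac (M : lmodType L) a (x : M) s :
  locmap p a *: frac x s = frac (a *: x) s.
Proof. by rewrite -[LHS]/(loc_scale _ _) loc_scaleE den_mul1. Qed.

Lemma linv_frac (M : lmodType L) (x : M) s t :
  linv s *: frac x t = frac x (den_mul s t).
Proof. by rewrite -[LHS]/(loc_scale _ _) loc_scaleE scale1r. Qed.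

Lemma frac_linv (M : lmodType L) (x : M) s :
  frac x s = linv s *: frac x (den_one p).
Proof. by rewrite linv_frac den_mulC den_mul1. Qed.

Lemma linvM s t : linv (den_mul s t) = linv s * linv t.
Proof. by rewrite -[RHS]/(linv s *: frac (1 : L^o) t) linv_frac. Qed.

Lemma linv_locmap s a : linv s * locmap p a = locmap p a * linv s.
Proof.
rewrite -[LHS]/(linv s *: frac (a : L^o) (den_one p)).
rewrite -[RHS]/(locmap p a *: frac (1 : L^o) s) linv_frac locmap_frac.
by rewrite den_mulC den_mul1; congr frac; apply: esym (mulr1 a).
Qed.

Lemma linvK s : linv s * alg_map Lp (den_val s) = 1.
Proof.
rewrite -[LHS]/(linv s * locmap p (alg_map L (den_val s))) linv_locmap.
rewrite -[LHS]/(locmap p (alg_map L (den_val s)) *: frac (1 : L^o) s).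
rewrite locmap_frac -[RHS]/(frac (1 : L^o) (den_one p)).
rewrite -(frac_cancel s (1 : L^o) (den_one p)); congr frac.
by rewrite den_mulC den_mul1.
Qed.

Lemma linvKr s : alg_map Lp (den_val s) * linv s = 1.
Proof. by rewrite alg_central linvK. Qed.

Lemma linv_scaleM (V : lmodType Lp) s t (v : V) :
  linv (den_mul s t) *: v = linv s *: (linv t *: v).
Proof. by rewrite linvM scalerA. Qed.

Lemma linv_scaleK (V : lmodType Lp) s (v : V) :
  linv s *: (alg_map Lp (den_val s) *: v) = v.
Proof. by rewrite scalerA linvK scale1r. Qed.

Lemma linv_scaleKr (V : lmodType Lp) s (v : V) :
  alg_map Lp (den_val s) *: (linv s *: v) = v.
Proof. by rewrite scalerA linvKr scale1r. Qed.

Lemma linv_linear (V : lmodType Lp) s :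
  linear (fun v : restr (locmap p (A := L)) V =>
            (linv s *: (v : V)) : restr (locmap p (A := L)) V).
Proof.
move=> a x y; rewrite scalerDr; congr (_ + _).
by rewrite -[LHS]/(linv s *: (locmap p a *: (x : V)))
  -[RHS]/(locmap p a *: (linv s *: (x : V))) !scalerA linv_locmap.
Qed.

Definition linvLinear (V : lmodType Lp) s := mkLinear (@linv_linear V s).

Lemma frac1_linear (M : lmodType L) :
  linear (fun x : M =>
    frac x (den_one p) : restr (locmap p (A := L)) (loc p M)).
Proof.
move=> a x y; rewrite -fracDl; congr (_ + _).
by rewrite -[RHS]/(locmap p a *: frac x (den_one p)) locmap_frac.
Qed.

Definition toLoc (M : lmodType L) := mkLinear (@frac1_linear M).

Lemma frac_eq0 (M : lmodType L) (x : M) s :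
  frac x s = 0 <-> exists u : den p, alg_map L (den_val u) *: x = 0.
Proof.
rewrite -[0]/(frac 0 (den_one p)) fracP; split=> -[u].
  by rewrite /= mulr1 scaler0; exists u.
by exists u; rewrite /= mulr1 scaler0.
Qed.

Section Criterion.
Variables (M : lmodType L) (N : lmodType Lp).
Variable f : {linear M -> restr (locmap p (A := L)) N}.
Hypothesis f_ker : forall x, f x = 0 ->
  exists u : den p, alg_map L (den_val u) *: x = 0.
Hypothesis f_im : forall y : N, exists x s,
  alg_map Lp (den_val s) *: y = f x.

Let h (m : loc p M) : N := linv (denom m) *: (f (numer m) : N).

Let linearf r x : f (alg_map L r *: x) = alg_map Lp r *: (f x : N).
Proof. by rewrite linearZ. Qed.

Let hE x s : h (frac x s) = linv s *: (f x : N).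
Proof.
(* [h] is computed from the representative picked by [numer] and [denom]; the equation [e] compares
   it with [(x, s)]. *)
have := fracK (frac x s); rewrite /h.
move: (numer _) (denom _) => x' s' /fracP[u e].
have := congr1 f e; rewrite !linearf => {}e.
have e' : alg_map Lp (den_val (den_mul u s)) *: (f x' : N) =
    alg_map Lp (den_val (den_mul u s')) *: (f x : N) := e.
rewrite -(linv_scaleK (den_mul u s) (f x' : N)) -linv_scaleM e'.
rewrite (_ : den_mul s' _ = den_mul s (den_mul u s')) //; last first.
  by apply: val_inj => /=; ring.
by rewrite linv_scaleM linv_scaleK.
Qed.

Let hD m n : h (m + n) = h m + h n.
Proof.
have [x [s ->]] := frac_surj m; have [y [t ->]] := frac_surj n.
rewrite fracD !hE linearD !linearf scalerDr; congr (_ + _).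
  by rewrite linv_scaleM linv_scaleK.
by rewrite den_mulC linv_scaleM linv_scaleK.
Qed.

Let hZ (a : locr p L) m : h (a *: m) = a *: h m.
Proof.
have [b [u ->]] := frac_surj a; have [x [s ->]] := frac_surj m.
rewrite -[(frac _ _ : locr p L) *: frac x s]/(loc_scale _ _) loc_scaleE !hE.
have -> : frac (b : L^o) u = linv u * locmap p b.
  by rewrite frac_linv.
have -> : f ((b : L) *: x) = locmap p b *: (f x : N) :> N by rewrite linearZ.
by rewrite linv_scaleM !scalerA -mulrA linv_locmap mulrA.
Qed.

Let h_linear : linear h.
Proof. by move=> a m n; rewrite hD hZ. Qed.

(** The map [h], sending x/s to (1/s) f(x), is injective by [f_ker] and surjective by [f_im]. *)
Lemma loc_isom : isom N (loc p M).
Proof.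
apply: isom_sym; exists (mkLinear h_linear).
have /choice[g gP] : forall y, exists m, h m = y.
  move=> y; have [x [s sy]] := f_im y.
  by exists (frac x s); rewrite hE -sy linv_scaleK.
exists g => // m; apply/eqP; rewrite -subr_eq0; apply/eqP.
have : h (g (h m) - m) = 0.
  rewrite -[h _]/(mkLinear h_linear _) linearB; apply/eqP.
  by rewrite subr_eq0 -[X in X == _]/(h _) gP.
have [x [s ->]] := frac_surj (g (h m) - m).
rewrite hE => /(congr1 (GRing.scale (alg_map Lp (den_val s)))).
by rewrite linv_scaleKr scaler0 => /f_ker/frac_eq0.
Qed.

End Criterion.

Section Saturation.
Variables (N : lmodType Lp) (Z : submod (restr (locmap p (A := L)) N)).

(** This is the [Lp]-submodule generated by [Z], written in the shape of the hypothesis [f_im]. *)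
Definition saturation_set : set N :=
  [set y | exists s, (alg_map Lp (den_val s) *: y) ∈ Z].

Fact saturation0 : saturation_set 0.
Proof. by exists (den_one p); rewrite scaler0; apply: submod0. Qed.
Fact saturationD x y :
  saturation_set x -> saturation_set y -> saturation_set (x + y).
Proof.
move=> [s Zx] [t Zy]; exists (den_mul s t); rewrite scalerDr rmorphM.
apply: (submodD (s := Z)); rewrite -?scalerA.
  rewrite scalerA alg_central -scalerA.
  exact: (submodZ (s := Z) (alg_map L (den_val t)) Zx).
exact: (submodZ (s := Z) (alg_map L (den_val s)) Zy).
Qed.
Fact saturationZ (z : Lp) x : saturation_set x -> saturation_set (z *: x).
Proof.
move=> [s Zx]; have [b [u ->]] := frac_surj z; exists (den_mul s u).
have -> : frac (b : L^o) u = linv u * locmap p b.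
  by rewrite frac_linv.
rewrite rmorphM -scalerA -[(_ * locmap p b) *: _]scalerA linv_scaleKr.
by rewrite scalerA alg_central -scalerA; apply: (submodZ (s := Z) b Zx).
Qed.

Definition saturation : submod N :=
  Submod saturation0 saturationD saturationZ.

End Saturation.

Section LocTors.
Variable T : tors (@fingen L).

Local Notation res N := (restr (locmap p (A := L)) N).

(** An elementwise condition, visibly stable under images, replaces the choice of a module over [L]
    that localizes to [N]. Conversely, finitely many generators lie in one submodule belonging to
    [T], and its localization is all of [N]. *)
Lemma locClassP (N : lmodType Lp) :
  locClass p T N <-> fingen N /\ forall y : res N, in_trace T y.
Proof.
split=> [[M TM /isom_sym[h [h' hK h'K]]]|[[n [g gN]] trN]].
  split.
    have [n [g gM]] := tors_fingen TM.
    exists n, (fun i => h (frac (g i) (den_one p))) => y.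
    have [x [s hy]] := frac_surj (h' y); have [c xE] := gM x.
    exists (fun i => linv s * locmap p (c i)); rewrite -[LHS]h'K hy frac_linv.
    rewrite -[frac x _]/(toLoc M x) xE.
    transitivity
      (h (linv s *: \sum_i locmap p (c i) *: frac (g i) (den_one p))).
      congr (h (linv s *: _)); rewrite linear_sum; apply: eq_bigr => i _.
      by rewrite linearZ.
    rewrite scaler_sumr linear_sum; apply: eq_bigr => i _.
    by rewrite scalerA linearZ.
  move=> y; have [x [s hy]] := frac_surj (h' y).
  (* With [h' y] equal to x/s, [y] is reached from [x] by localizing, multiplying by 1/s and
     applying [h]; all three maps are [L]-linear. *)
  pose k :=
    restrLinear (locmap p (A := L)) h \o linvLinear (loc p M) s \o toLoc M.
  have <- : k x = y by rewrite -(h'K y) hy frac_linv.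
  exact: trace_range.
have [Z TZ Zg] := trace_family (g := g : 'I_n -> res N) (fun i => trN _).
exists (smod Z) => //.
apply: (@loc_isom _ _ (smod_val : {linear smod Z -> res N})) => [x x0|y].
  have -> : x = 0 by apply: smod_val_inj; rewrite x0 linear0.
  by exists (den_one p); rewrite scaler0.
(* The saturation is an [Lp]-submodule containing the generators of [N]. *)
have [s /smod_ex[x xy]] : y ∈ saturation Z; last by exists x, s.
apply: (span_min _ (gN y)) => i; exists (den_one p).
by rewrite rmorph1 scale1r; apply: Zg.
Qed.
End LocTors.

End Localization.

(** * Finite length *)

Definition strict_chain (A : pzRingType) (M : lmodType A) m
    (F : nat -> submod M) : Prop :=
  forall i, (i < m)%N -> (F i : set M) `<` F i.+1.

(* A strict chain of maximal length is a composition series. *)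
Lemma finlen_bounded (A : pzRingType) (M : lmodType A) b :
  (forall m (F : nat -> submod M), strict_chain m F -> (m <= b)%N) -> finlen M.
Proof.
move=> bnd.
(* Only chains starting at zero compete; both modifications below keep that start. *)
pose P m := `[< exists2 F : nat -> submod M,
  strict_chain m F & F 0%N = zerosub M >].
have exP : exists m, P m by exists 0%N; apply/asboolP; exists (fun=> zerosub M).
have Pb m : P m -> (m <= b)%N by move=> /asboolP[F /bnd].
case: (ex_maxnP exP Pb) => m /asboolP[F Fm F0] maxm.
exists m, F; split; first by rewrite F0.
  apply/seteqP; split=> // x _; apply: contrapT => Fx.
  suff : P m.+1 by move=> /maxm; rewrite ltnn.
  (* If the top term were proper, the whole module could be added above it. *)
  apply/asboolP; exists (fun i => if (i <= m)%N then F i else subT M) => //.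
  move=> i; rewrite ltnS => im; rewrite im; case: ltnP => [/Fm//|mi].
  split=> // /(_ x I); have -> // : i = m by apply/eqP; rewrite eqn_leq im.
move=> i im; split=> [|N FN NF]; first exact: Fm.
apply: contrapT => /not_orP[N1 N2].
suff : P m.+1 by move=> /maxm; rewrite ltnn.
(* [N] is inserted right after [F i], and later terms move up by one, hence [j.-1]. *)
apply/asboolP; exists (fun j => if (j <= i)%N then F j else
  if j == i.+1 then N else F j.-1) => //.
move=> j; rewrite ltnS => jm; case: (ltngtP j i) => [ji|ij|->].
- exact/Fm/(ltn_trans ji).
- rewrite eqSS (gtn_eqF ij) /=; case: eqP => [->|_].
    by split=> // NS; apply: N2; exact/seteqP.
  by case: j jm ij => // j jm _; apply: Fm.
- rewrite eqxx; split=> // NS; apply: N1; exact/seteqP.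
Qed.

Lemma finlen_zero (A : pzRingType) (M : lmodType A) :
  (forall x : M, x = 0) -> finlen M.
Proof.
move=> M0; exists 0%N, (fun=> zerosub M); split=> //.
by apply/seteqP; split=> // x _; apply: M0.
Qed.

Lemma finlen_isom (A : pzRingType) (M N : lmodType A) :
  finlen M -> isom M N -> finlen N.
Proof.
move=> [n [F [F0 Fn FP]]] /isom_sym[g [h gK hK]].
exists n, (fun i => preimsub g (F i)); split.
- apply/seteqP; split=> x /=; rewrite -/(submod_set _ _) F0 /=.
    by move=> gx; rewrite -(gK x) gx -(linear0 g) gK.
  by move=> ->; rewrite linear0.
- by apply/seteqP; split=> x //= _; rewrite -/(submod_set _ _) Fn.
- move=> i /FP[[Fi nFi] Fmax]; split; first split.
  + by move=> x /=; apply: Fi.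
  + by move=> sub; apply: nFi => x Fx; have := sub (h x); rewrite /= hK; apply.
  + move=> Z FZ ZF; have hZ x : x ∈ imsub g Z <-> h x ∈ Z.
      split=> [[z Zz <-]|]; first by rewrite gK.
      by move=> hx; exists (h x); rewrite ?hK.
    have [||e|e] := Fmax (imsub g Z).
    * by move=> x Fx; apply/hZ/FZ; rewrite /= hK.
    * by move=> x /hZ/ZF; rewrite /= hK.
    * left; apply/seteqP; split=> x /=; rewrite -e => gx.
        by exists x.
      by move/hZ: gx; rewrite gK.
    * right; apply/seteqP; split=> x /=; rewrite -e => gx.
        by exists x.
      by move/hZ: gx; rewrite gK.
Qed.

Section ResidueField.
Variables (R : comPzRingType) (L : pzAlg R) (p : spec R).

Local Notation Lp := (locAlg p L).

Variable V : lmodType Lp.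
Hypothesis pV : forall r (v : V), (p : set R) r -> alg_map Lp r *: v = 0.

Lemma submod_den (F : submod V) (s : den p) v :
  alg_map Lp (den_val s) *: v ∈ F -> v ∈ F.
Proof. by move=> /(submodZ (linv L s)); rewrite linv_scaleK. Qed.

(* V/F is a vector space over the residue field at p, spanned by the g i. *)
Definition spans_over (F : submod V) n (g : 'I_n -> V) := forall v,
  exists (s : den p) (c : 'I_n -> R),
    alg_map Lp (den_val s) *: v - \sum_i alg_map Lp (c i) *: g i ∈ F.

Lemma spans_over_exchange (F G : submod V) n (g : 'I_n.+1 -> V) v :
  spans_over F g -> (forall x, x ∈ F -> x ∈ G) -> v ∈ G -> ~ v ∈ F ->
  exists g' : 'I_n -> V, spans_over G g'.
Proof.
move=> Fg FG Gv nFv; have [s [c Fv]] := Fg v.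
(* If all [c i] were in [p], the sum would vanish by [pV], and the invertible [s] would put [v] in
   [F]. *)
have [j cj] : exists j, c j \notin (p : set R).
  apply: contrapT => nc; apply: nFv; apply: (submod_den (s := s)).
  rewrite -[X in X ∈ _](subr0) -[0](_ : \sum_i alg_map Lp (c i) *: g i = 0) //.
  apply: big1 => i _; apply: pV; apply: contrapT => ci; apply: nc; exists i.
  by rewrite notin_setE.
pose d := Den cj; exists (fun i => g (lift j i)) => w.
have [t [b Fw]] := Fg w.
(* Add [b j] times the relation for [v] to [c j] times that for [w], with signs chosen so that [g j]
   cancels; [v] itself vanishes modulo [G]. *)
exists (den_mul d t), (fun i => c j * b (lift j i) - b j * c (lift j i)).
have := submodD (submodZ (alg_map Lp (c j)) (FG _ Fw))
  (submodZ (alg_map Lp (b j))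
    (submodB (submodZ (alg_map Lp (den_val s)) Gv) (FG _ Fv))).
have sumE (e : 'I_n.+1 -> R) : \sum_i alg_map Lp (e i) *: g i =
    alg_map Lp (e j) *: g j + \sum_i alg_map Lp (e (lift j i)) *: g (lift j i).
  by rewrite (bigD1_ord j).
rewrite subKr !sumE; congr (_ ∈ _).
rewrite scalerBr !scalerDr !scalerA -!rmorphM [b j * c j]mulrC !opprD.
rewrite -[LHS]addrA; congr (_ + _); rewrite [LHS]addrACA addNr add0r.
rewrite !scaler_sumr addrC -sumrB -sumrN; apply: eq_bigr => i _.
by rewrite -[RHS]scaleNr -rmorphN opprB rmorphB scalerBl !rmorphM !scalerA.
Qed.

(** Every strict step removes a generator by exchange; once none is left, the bottom term is all of
    [V]. *)
Lemma strict_chain_bound n (g : 'I_n -> V) m (F : nat -> submod V) :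
  spans_over (F 0%N) g -> strict_chain m F -> (m <= n)%N.
Proof.
elim: n g m F => [|n IHn] g [|m] F F0g Fm //.
  have [_ []] := Fm 0%N isT; move=> v _; have [s [c]] := F0g v.
  by rewrite big_ord0 subr0 => /submod_den.
have [F01 nF10] := Fm 0%N isT.
have [v Fv nFv] : exists2 v, v ∈ F 1%N & ~ v ∈ F 0%N.
  apply: contrapT => nv; apply: nF10 => v Fv; apply: contrapT => nFv.
  by apply: nv; exists v.
have [g' Fg'] := spans_over_exchange F0g F01 Fv nFv.
by apply: (IHn g' m (fun i => F i.+1)) => // i im; apply: Fm.
Qed.

Lemma finlen_residue n (g : 'I_n -> V) : spans_over (zerosub V) g -> finlen V.
Proof.
move=> gV; apply: (finlen_bounded (b := n)) => m F Fm.
apply: (strict_chain_bound (g := g) _ Fm) => v; have [s [c vE]] := gV v.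
by exists s, c; rewrite [_ - _]vE; apply: submod0.
Qed.

End ResidueField.

(** * Torsion classes under localization *)

Lemma isom_refl (A : pzRingType) (M : lmodType A) : isom M M.
Proof. by exists idfun; exists id. Qed.

Lemma isom_trans (A : pzRingType) (M N P : lmodType A) :
  isom M N -> isom N P -> isom M P.
Proof. by move=> [f bf] [g bg]; exists (g \o f); apply: bij_comp. Qed.

Lemma isom_of_bij (A : pzRingType) (M N : lmodType A) (f : {linear M -> N}) :
  injective f -> (forall y, exists x, f x = y) -> isom M N.
Proof.
move=> f_inj /choice[g gK]; exists f; exists g => // x.
exact/f_inj/gK.
Qed.

Section NoetherianLocalization.
Variables (R : comPzRingType) (L : pzAlg R).
Hypothesis noeL : noetherian_algebra L.

(** It is applied to localizations, which need not be finitely generated over [L], so closure of [T]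
    under extensions cannot be used on [N] itself. It is used on a submodule [spansub e + f(Z)], an
    extension of [Q] by [f(Z)], that contains a lift of [g y]. *)
Lemma in_trace_extension (T : tors (@fingen L)) (M N P : lmodType L)
    (f : {linear M -> N}) (g : {linear N -> P}) :
  short_exact f g -> (forall x : M, in_trace T x) ->
  (forall z : P, in_trace T z) -> forall y : N, in_trace T y.
Proof.
move=> [_ ker_g gS] trM trP y; have [Q TQ Qgy] := trP (g y).
have [n [q [Qq qQ]]] := (fingen_smod Q).2 (tors_fingen TQ).
have /choice[e eq] : forall i, exists e, g e = q i by move=> i; apply: gS.
(* The span of the lifts may meet the image of [f]. The intersection is finitely generated, so one
   [Z] in [T] can be chosen whose image covers it. *)
have [m [w [wP wK]]] := noetherian_alg_fgset noeL (g := e)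
  (S := capsub (spansub e) (imsub f (subT M))) (fun x => @proj1 _ _).
have /choice[v vw] : forall j, exists v, f v = w j.
  by move=> j; have [_ [v]] := wP j; exists v.
have [Z TZ Zv] := trace_family (g := v) (fun j => trM _).
have TW : tors_class T (smod (sumsub (spansub e) (imsub f Z))).
  apply: (tors_sub_extension (g := g) (Z := imsub f Z) (Q := Q)) => //.
  - move=> x; split=> [[z Zz <-]|].
      by split; [apply: sumsubr; exists z|apply/ker_g; exists z].
    move=> [[a [b [ea [z Zz <-] ->]]] gx].
    apply: submodD; last by exists z.
    have ga : g a = 0.
      have gfz : g (f z) = 0 by apply/ker_g; exists z.
      by move: gx; rewrite linearD gfz addr0.
    have [u ua] := (ker_g a).1 ga.
    apply: (span_min _ (wK a _)) => [j|]; first by exists (v j).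
    by split=> //; exists u.
  - apply/seteqP; split=> x.
      move=> [_ [a [b [ea [z Zz <-] ->]]] <-].
      rewrite linearD (_ : g (f z) = 0) ?addr0; last by apply/ker_g; exists z.
      have : g a ∈ spansub (g \o e) by apply: span_image.
      by apply: span_min => i /=; rewrite eq.
    move=> /qQ[c ->]; exists (\sum_i c i *: e i).
      by apply: sumsubl; exists c.
    by rewrite linear_sum; apply: eq_bigr => i _; rewrite linearZ eq.
  - exact: tors_imsub.
(* [y'] has the same image as [y], so [y - y'] comes from [M]. *)
have [c gyE] := qQ _ Qgy; pose y' := \sum_i c i *: e i.
have [|u fu] := (ker_g (y - y')).1.
  rewrite linearB gyE linear_sum -sumrB big1 // => i _.
  by rewrite linearZ eq subrr.
rewrite -(subrK y' y) -fu; apply: traceD; first exact: trace_image.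
by exists (sumsub (spansub e) (imsub f Z)) => //; apply: sumsubl; exists c.
Qed.

Section AtPrime.
Variables (p : spec R).
Local Notation Lp := (locAlg p L).

Lemma locClass_image (T : tors (@fingen L)) (M N : lmodType Lp)
    (f : {linear M -> N}) :
  (forall y, exists x, f x = y) -> locClass p T M -> locClass p T N.
Proof.
move=> fS /locClassP[fgM trM]; apply/locClassP; split.
  exact: fingen_image fS fgM.
move=> y; have [x <-] := fS y.
exact: (trace_image (restrLinear (locmap p (A := L)) f) (trM x)).
Qed.

Lemma locClass_extension (T : tors (@fingen L)) (M N P : lmodType Lp)
    (f : {linear M -> N}) (g : {linear N -> P}) :
  short_exact f g -> locClass p T M -> locClass p T P -> locClass p T N.
Proof.
move=> fg /locClassP[fgM trM] /locClassP[fgP trP]; apply/locClassP; split.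
  exact: fingen_ext fg fgM fgP.
by apply: (@in_trace_extension T _ _ _ (restrLinear (locmap p (A := L)) f)
  (restrLinear (locmap p (A := L)) g)).
Qed.

Lemma locClass_fl_torsion (T : tors (@fingen L)) :
  is_torsion (@finlen Lp) (fun N => locClass p T N /\ finlen N).
Proof.
split.
- by move=> M [].
- move=> M M0; split; last exact: finlen_zero.
  apply/locClassP; split.
    by exists 0%N, (fun=> 0) => x; exists (fun=> 0); rewrite big_ord0.
  by move=> y; rewrite (M0 y); apply: trace0.
- move=> M N [TM fM] MN; split; last exact: finlen_isom fM MN.
  have [f [g fK gK]] := MN.
  by apply: (locClass_image (f := f)) => // y; exists (g y).
- move=> M N P f g fg fN [TM _] [TP _]; split=> //.
  exact: locClass_extension fg TM TP.
- by move=> M N f fS fN [TM _]; split=> //; apply: locClass_image fS TM.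
Qed.

(** Denominators are cleared so that the coefficients lie in [R], as in [spans_over]. *)
Lemma loc_generated (X : lmodType L) : fingen X ->
  exists n (g : 'I_n -> loc p X), forall m, exists (s : den p) (c : 'I_n -> R),
    alg_map Lp (den_val s) *: m = \sum_i alg_map Lp (c i) *: g i.
Proof.
move=> /(fingen_restr noeL)[n [g gX]].
exists n, (fun i => toLoc p X (g i)) => m; have [x [s ->]] := frac_surj m.
have [c xE] := gX x; exists s, c.
rewrite frac_linv linv_scaleKr -[LHS]/(toLoc p X x) xE linear_sum.
by apply: eq_bigr => i _; rewrite -[c i *: _]/(alg_map L (c i) *: _) linearZ.
Qed.

(** Such a [V] is a finite-dimensional vector space over the residue field. This serves both for X_p
    / pX_p and for a localization that [p] already kills. *)
Lemma killed_fingen_finlen (X : lmodType L) (V : lmodType Lp)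
    (f : {linear loc p X -> V}) :
  (forall y, exists x, f x = y) -> fingen X ->
  (forall r (v : V), (p : set R) r -> alg_map Lp r *: v = 0) -> finlen V.
Proof.
move=> fS /loc_generated[n [g gX]] pV.
apply: (finlen_residue pV (g := f \o g)) => v.
have [m <-] := fS v; have [s [c mE]] := gX m; exists s, c.
rewrite -linearZ mE linear_sum -sumrB; apply: (submod_sum (N := zerosub V)).
move=> i _; rewrite [f _]linearZ -[(f \o g) i]/(f (g i)) subrr.
exact: (submod0 (zerosub V)).
Qed.

Lemma residue_finlen (X : lmodType L) :
  fingen X -> finlen (qmod (@idealmod R Lp p (loc p X))).
Proof.
move=> fgX; pose pi := qproj (@idealmod R Lp p (loc p X)).
apply: (@killed_fingen_finlen X _ pi) => [y||r v pr] //.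
  by have [x ->] := qproj_surj y; exists x.
have [x ->] := qproj_surj v; rewrite -linearZ -(linear0 (qproj _)).
apply/qprojP; rewrite subr0; exists [:: (r, x)]; split=> [a|].
  by rewrite inE => /eqP ->.
by rewrite big_seq1.
Qed.

End AtPrime.

(** The criterion [loc_isom] applies to the composite X -> X_p -> (X_p)_q, since denominators at [p]
    are also denominators at [q]. *)
Lemma loc_loc_isom (p q : spec R) (X : lmodType L) :
  (q : set R) `<=` p ->
  isom (loc q X) (loc q (restr (locmap p (A := L)) (loc p X))).
Proof.
move=> qp; pose f := toLoc q (restr (locmap p (A := L)) (loc p X)) \o toLoc p X.
have pq (s : den p) : den_val s \notin (q : set R).
  by apply/negP; rewrite inE => /qp; have := den_valP s; rewrite notin_setE.
apply: isom_sym; apply: (@loc_isom _ _ _ _ _ f).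
  move=> x /frac_eq0[u]; rewrite -linearZ => /frac_eq0[v].
  rewrite scalerA -rmorphM => e.
  by exists (den_mul (Den (pq v)) u).
move=> m; have [m' [t ->]] := frac_surj m.
have [x [s m'E]] := frac_surj (m' : loc p X).
exists x, (den_mul t (Den (pq s))).
rewrite frac_linv [den_val _]mulrC rmorphM -scalerA linv_scaleKr.
rewrite -[frac m' _]/(toLoc q (restr (locmap p (A := L)) _) m').
rewrite -[LHS]/(alg_map L (den_val s) *: toLoc q _ _) -linearZ.
congr (toLoc q _ _); rewrite m'E frac_linv.
exact: (linv_scaleKr s (frac x (den_one p) : loc p X)).
Qed.

(** * Reflection of the order *)

Lemma common_den (p : spec R) n (D : 'I_n -> R -> Prop) :
  (forall i a r, D i r -> D i (a * r)) ->
  (forall i, exists s : den p, D i (den_val s)) ->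
  exists s : den p, forall i, D i (den_val s).
Proof.
elim: n D => [|n IHn] D DM Ds; first by exists (den_one p) => -[].
have [s sD] := Ds ord0.
have [t tD] := IHn (fun i => D (lift ord0 i)) (fun i => DM _) (fun i => Ds _).
exists (den_mul s t) => i; case: (unliftP ord0 i) => [j|] ->.
  by apply: DM; apply: tD.
by rewrite den_mulC; apply: DM.
Qed.

(** If [a * b] kills [Y] and [b] does not kill [y], then [a] kills the nonzero element [b y], hence
    all of [Y]. *)
Lemma annihilator_prime (Y : lmodType L) :
  (exists y : Y, y <> 0) ->
  (forall r, (exists2 y : Y, y <> 0 & alg_map L r *: y = 0) ->
     forall y : Y, alg_map L r *: y = 0) ->
  prime_ideal [set r | forall y : Y, alg_map L r *: y = 0].
Proof.
move=> [y0 y0n] Yr; split; first split.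
- by move=> y; rewrite rmorph0 scale0r.
- by move=> r s r0 s0 y; rewrite rmorphD scalerDl r0 s0 addr0.
- by move=> a r r0 y; rewrite rmorphM -scalerA r0 scaler0.
- by move=> /(_ y0); rewrite rmorph1 scale1r.
- move=> a b ab; apply: contrapT => /not_orP[na /existsNP[y nby]].
  apply: na; apply: Yr; exists (alg_map L b *: y); first exact: nby.
  by rewrite scalerA -rmorphM.
Qed.

Lemma homothety_linear (Y : lmodType L) r :
  linear (fun y : Y => alg_map L r *: y).
Proof. by move=> a x y; rewrite scalerDr !scalerA alg_central. Qed.

Lemma tors_le_locClass (T U : tors (@fingen L)) :
  (forall p (N : lmodType (locAlg p L)),
     locClass p T N -> finlen N -> locClass p U N) ->
  tors_le T U.
Proof.
move=> TU X TX; apply: contrapT => nUX.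
have noeX (S : submod X) : fgset S.
  have [n [g gX]] := tors_fingen TX.
  exact: (noetherian_alg_fgset noeL (fun x _ => gX x)).
have [Y [f [fS nUY Ymin]]] := minimal_quotient_outside noeX nUX.
have TY := tors_image fS TX.
have [y0 y0n] : exists y : Y, y <> 0.
  apply: contrapT => Y0; apply: nUY; apply: (torsion_zero (torsP U)) => y.
  by apply: contrapT => yn; apply: Y0; exists y.
(* A nonzero submodule [V] in [U] is impossible: [Y / V] is a proper quotient, hence in [U], and [Y]
   would be an extension of the two. *)
have U_ext (V : submod Y) : (exists2 y, y <> 0 & y ∈ V) ->
    tors_class U (smod V) -> False.
  move=> [y yn Vy] UV; apply: nUY.
  apply: (tors_extension (f := smod_val) (g := qproj V) _ UV).
    split; first exact: smod_val_inj.
      move=> z; rewrite -(linear0 (qproj V)) qprojP subr0.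
      split=> [/smod_ex[v]|[v <-]]; [by exists v|exact: smod_valP].
    by move=> z; have [x ->] := qproj_surj z; exists x.
  apply: (Ymin _ (qproj V)).
    by move=> z; have [x ->] := qproj_surj z; exists x.
  by exists y => //; rewrite -(linear0 (qproj V)); apply/qprojP; rewrite subr0.
have Yr r : (exists2 y : Y, y <> 0 & alg_map L r *: y = 0) ->
    forall y : Y, alg_map L r *: y = 0.
  move=> [y yn ry] y1; apply: contrapT => ry1.
  pose h := mkLinear (@homothety_linear Y r).
  (* [rY] is nonzero because of [y1], and it is a proper quotient of [Y] because [r] kills [y]. *)
  apply: (@U_ext (imsub h (subT Y))); first by exists (h y1) => //; exists y1.
  have hI z : h z ∈ imsub h (subT Y) by exists z.
  apply: (Ymin _ (corestr hI)) => [z|].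
    have [x _ hx] := smod_valP z; exists x.
    by apply: smod_val_inj; rewrite corestrE.
  by exists y => //; apply: smod_val_inj; rewrite corestrE linear0.
(* Denominators at this prime do not annihilate [Y], so by [Yr] they act injectively. *)
pose p := Spec (annihilator_prime (ex_intro _ y0 y0n) Yr).
have denY (s : den p) (y : Y) : alg_map L (den_val s) *: y = 0 -> y = 0.
  move=> sy; apply: contrapT => yn; have := den_valP s; rewrite notin_setE.
  by apply; apply: (Yr _); exists y.
have toLocI : injective (toLoc p Y).
  move=> x y xy; apply/eqP; rewrite -subr_eq0; apply/eqP.
  have /frac_eq0[u] : toLoc p Y (x - y) = 0 by rewrite linearB xy subrr.
  exact: denY.
(* Elements of [p] kill [Y] and hence Y_p, so the identity is an admissible quotient map. *)
have finY : finlen (loc p Y).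
  apply: (@killed_fingen_finlen p Y _ idfun) => [y||r m pr].
  - by exists y.
  - exact: tors_fingen TY.
  have [x [s ->]] := frac_surj m.
  by rewrite locmap_frac pr frac0.
have [Z UZ Zy0] : in_trace U (toLoc p Y y0).
  have [] // := (locClassP U (loc p Y)).1 (TU p _ _ finY).
  by exists Y => //; apply: isom_refl.
have [n [g [Zg gZ]]] := (fingen_smod Z).2 (tors_fingen UZ).
(* One denominator [s] moves all generators of [Z], and thus all of [Z], into the image of [Y]. *)
have [||s sg] := @common_den p n
  (fun i r => exists y, toLoc p Y y = alg_map L r *: g i).
- move=> i a r [y yE]; exists (alg_map L a *: y).
  by rewrite linearZ yE rmorphM -scalerA.
- move=> i; have [y [s gE]] := frac_surj (g i : loc p Y); exists s, y.
  by rewrite gE frac_linv; apply: esym; apply: (linv_scaleKr (L := L)).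
pose h := mkLinear
  (@homothety_linear (restr (locmap p (A := L)) (loc p Y)) (den_val s)).
(* [V] is the part of [Y] that lands in [sZ]. It contains the nonzero element [s y0] and is
   isomorphic to [sZ], a factor of [Z]. *)
pose V := preimsub (toLoc p Y) (imsub h Z).
apply: (@U_ext V).
  exists (alg_map L (den_val s) *: y0); first by move=> /denY.
  by exists (toLoc p Y y0) => //; rewrite -[LHS]/(alg_map L _ *: _) -linearZ.
have kV (v : smod V) : (toLoc p Y \o smod_val) v ∈ imsub h Z.
  exact: (smod_valP v).
apply: (torsion_isom (torsP U) (tors_imsub h UZ)); apply: isom_sym.
apply: (@isom_of_bij _ _ _ (corestr kV)) => [x y|z].
  move=> /(congr1 smod_val); rewrite !corestrE => /toLocI; exact: smod_val_inj.
have [w Zw wz] := smod_valP z.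
have [y yw] : exists y, toLoc p Y y = h w.
  have : w ∈ preimsub h (imsub (toLoc p Y) (subT Y)).
    apply: (span_min _ (gZ _ Zw)) => i.
    by have [y yE] := sg i; exists y.
  by case=> y _ yw; exists y.
have [|v vy] := @smod_ex _ _ V y; first by exists w; rewrite // yw.
exists v; apply: smod_val_inj.
by rewrite corestrE -[LHS]/(toLoc p Y (smod_val v)) vy yw.
Qed.

End NoetherianLocalization.

(** * The embedding into compatible families *)

Theorem proposition1p4 (R : comPzRingType) (L : pzAlg R) :
  noetherian_algebra L ->
  exists Phi : torsL L -> TR L,
    [/\ forall (T : torsL L) (p : spec R) (N : lmodType (locAlg p L)),
          tors_class (Phi T p) N <-> locClass p T N /\ finlen N,
        forall T : torsL L, compatible (Phi T)
      & exists Phic : torsL L -> TcR L,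
          (forall T : torsL L, sval (Phic T) = Phi T) /\
          order_embedding (@tors_le _ _) (@TcR_le R L) Phic].
Proof.
move=> noeL.
pose Phi (T : torsL L) : TR L := fun p => Tors (locClass_fl_torsion noeL p T).
have Phic T : compatible (Phi T).
  (* [N] is isomorphic to X_q with [X] in [T]; the member of [psi] that localizes to it is X_p. *)
  move=> p q qp N [[X TX NX] fN]; split=> //; exists (loc p X); last first.
    exact: isom_trans NX (loc_loc_isom X qp).
  have fgX := tors_fingen TX.
  have locX : locClass p T (loc p X) by exists X => //; apply: isom_refl.
  split; first by have [] := (locClassP T (loc p X)).1 locX.
  split; last exact: residue_finlen.
  pose pi := qproj (@idealmod R (locAlg p L) p (loc p X)).
  apply: (locClass_image (f := pi) _ locX).
  by move=> y; have [x ->] := qproj_surj y; exists x.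
exists Phi; split=> //; exists (fun T => exist _ (Phi T) (Phic T)); split=> //.
split=> [T U TU p N [[X TX NX] fN]|T U TU].
  by split=> //; exists X => //; apply: TU.
apply: (tors_le_locClass noeL) => p N TN fN.
by have [] : tors_class (Phi U p) N by apply: TU.
Qed.
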